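(* Suppose the network, problem and stochastic-gradient assumptions listed in the context hold, and let the iterates be generated by the LSGT algorithm described in the context with $\gamma=\sqrt{\frac{N}{ET}}$ and $E\le\big(\frac{T}{N^5}\big)^{1/3}$, where $T$ is sufficiently large so that $\gamma<1$ and $\gamma$ satisfies all of the following (write $\lambda=\lambda_w$): (i) $\gamma\le \frac{\lambda^2}{32ENL}$; (ii) $\gamma\le \frac{(1-\lambda^2)^2}{32L^2(1+7\lambda^2)\,[8(1+16\lambda^2)(E-1)^2]}$ (no restriction if $E=1$); (iii) $\gamma\le\frac{1-\lambda^2}{3600ENL}$; (iv) there exist $s_1,s_2>0$ with $s_1<\frac{(1-\lambda^2)^2}{40(1+7\lambda^2)(1+\lambda^2)L^2}s_2$ such that $\gamma\le\frac{3(1-\lambda^2)s_1}{16(1+7\lambda^2)[1+8(E-1)\lambda]s_2}$; (v) $\gamma\le\frac{3(1-\lambda^2)^2}{320(1+7\lambda^2)(1+\lambda^2)[1+8(E-1)\lambda]NL}$; (vi) $\gamma\le\frac{1}{62E(1+\lambda^2)NL}$; (vii) $\gamma\le\frac{1-\lambda^2}{320E^2NL}$. Then $$\frac1T\sum_{r=0}^{T-1}\mathbb E\Big[\Big\|\frac1N\sum_{n=1}^N\nabla f_n(\mathbf y_n^r)\Big\|^2\Big]\le\frac{4(F(\bar{\mathbf y}^0)-\underline F)}{\sqrt{NET}}+\frac{40L\sigma^2}{\sqrt{NET}\,|\mathcal I|}+\frac{16(1+7\lambda_w^2)^2L^2}{(1-\lambda_w^2)^4\sqrt{NET}}\Big(\frac{2577\sigma^2}{|\mathcal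 I|}+\frac{111\,\phi_v^0}{NT}\Big).$$
   Context: Network: $N$ agents $[N]=\{1,\dots,N\}$ are the vertices of an undirected connected graph $\mathcal G=(\mathcal E,\mathcal V)$ with edge set $\mathcal E$. The mixing matrix $\mathbf W\in\mathbb R^{N\times N}$ satisfies $W_{n,m}>0$ for $(n,m)\in\mathcal E$ and $W_{n,m}=0$ otherwise, is doubly stochastic ($\mathbf W\mathbf 1=\mathbf 1$, $\mathbf 1^\top\mathbf W=\mathbf 1^\top$), and $\lambda_w:=\|\mathbf W-\frac1N\mathbf 1\mathbf 1^\top\|$ (largest singular value) satisfies $|\lambda_w|<1$. $\mathbf W$ need not be symmetric. Problem: $F(\mathbf y)=\frac1N\sum_{n=1}^N f_n(\mathbf y)$, $\mathbf y\in\mathbb R^p$, with $f_n:\mathbb R^p\to\mathbb R$ smooth and possibly nonconvex; $f_n(\mathbf y)=\mathbb E_{\xi\sim\mathcal D_n}[\ell_n(\mathbf y,\xi)]$ with local dataset $\mathcal D_n$ and loss $\ell_n$. Assumptions: $F(\mathbf y)\ge\underline F$ for all $\mathbf y$; $\|\nabla f_n(\mathbf y)-\nabla f_n(\mathbf y')\|\le L\|\mathbf y-\mathbf y'\|$ for all $\mathbf y,\mathbf y'$ and all $n$. Stochastic gradients: at a point $\mathbf y_n$, agent $n$ uses $\mathbf g_n=\frac1{|\mathcal I|}\sum_{\xi\in\mathcal I_n}\nabla\ell_n(\mathbf y_n;\xi)$, where $\mathcal I_n\subseteq\mathcal D_n$ is a randomly chosen mini-batch of size $|\mathcal I|$ (the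 same size for all agents). Assumption: $\mathbb E[\mathbf g_n]=\nabla f_n(\mathbf y_n)$ and $\mathbb E[\|\mathbf g_n-\nabla f_n(\mathbf y_n)\|^2]\le\sigma^2/|\mathcal I|$. LSGT algorithm (step size $\gamma>0$, integer $E\ge1$ local updates, rounds $r=0,1,\dots,T$): initialize $\mathbf y_1^0=\dots=\mathbf y_N^0$ and $\mathbf v_n^0=\mathbf g_n^0$, where $\mathbf g_n^0$ is a mini-batch gradient at $\mathbf y_n^0$. In round $r$ each agent $n$ sets $\mathbf y_n^{r,0}=\sum_m W_{n,m}\mathbf y_m^r$, $\mathbf v_n^{r,0}=\sum_m W_{n,m}\mathbf v_m^r$, $\mathbf g_n^{r,0}=\mathbf g_n^r$; then for $q=1,\dots,E$: $\mathbf y_n^{r,q}=\mathbf y_n^{r,q-1}-\gamma\mathbf v_n^{r,q-1}$, and $\mathbf v_n^{r,q}=\mathbf v_n^{r,q-1}+\mathbf g_n^{r,q}-\mathbf g_n^{r,q-1}$, where $\mathbf g_n^{r,q}$ is the mini-batch gradient at $\mathbf y_n^{r,q}$ with a randomly chosen mini-batch $\mathcal I_n^{r,q}\subseteq\mathcal D_n$; finally $\mathbf y_n^{r+1}=\mathbf y_n^{r,E}$, $\mathbf v_n^{r+1}=\mathbf v_n^{r,E}$, $\mathbf g_n^{r+1}=\mathbf g_n^{r,E}$. Notation: $\bar{\mathbf y}^r=\frac1N\sum_n\mathbf y_n^r$, $\bar{\mathbf v}^r=\frac1N\sum_n\mathbf v_n^r$, $\mathbf V^r=[\mathbf v_1^r,\dots,\mathbf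 v_N^r]^\top$, $\phi_v^r=\mathbb E[\|\mathbf V^r-\mathbf 1(\bar{\mathbf v}^r)^\top\|_F^2]$. *)

(* Defs.v *)
From HB Require Import structures.
From mathcomp Require Export all_boot all_order all_algebra.
From mathcomp Require Export all_classical all_reals all_analysis.

Set Implicit Arguments.
Unset Strict Implicit.
Unset Printing Implicit Defensive.

Export Order.TTheory GRing.Theory Num.Theory.
Export numFieldNormedType.Exports.

Local Open Scope classical_set_scope.
Local Open Scope ring_scope.

Section linear_algebra.
Variable R : realType.

(* Frobenius norm; on row vectors it is the Euclidean norm (the library norm
   `|A| on matrices is the max norm). *)
Definition fnorm m n (A : 'M[R]_(m, n)) : R :=
  Num.sqrt (\sum_(i < m) \sum_(j < n) A i j ^+ 2).

(* The singular values of A are the square roots of the eigenvalues of A^T A. *)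
Definition singular_value n (A : 'M[R]_n) : set R :=
  [set Num.sqrt a | a in [set a | eigenvalue (A^T *m A) a]].

Definition largest_singular_value n (A : 'M[R]_n) : R := sup (singular_value A).

Definition row_mean N p (Y : 'M[R]_(N, p)) : 'rV[R]_p :=
  N%:R^-1 *: \sum_(n < N) row n Y.

Definition gradient p (f : 'rV[R]_p -> R) (y : 'rV[R]_p) : 'rV[R]_p :=
  \row_(i < p) 'D_(delta_mx 0 i) f y.

End linear_algebra.

(* W n m > 0 on edges and W n m = 0 elsewhere, W doubly stochastic.  The edge
   relation may contain self-loops, so diagonal weights may be positive. *)
Definition mixing_matrix (R : realType) N (edge : rel 'I_N) (W : 'M[R]_N) : Prop :=
  [/\ forall n m, edge n m -> 0 < W n m,
      forall n m, ~~ edge n m -> W n m = 0,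
      W *m (const_mx 1 : 'cV[R]_N) = const_mx 1 &
      (const_mx 1 : 'rV[R]_N) *m W = const_mx 1].

Definition connected_graph N (edge : rel 'I_N) : Prop :=
  symmetric edge /\ forall n m, connect edge n m.

Definition mutually_independent d d' (Omega : measurableType d) (R : realType)
    (P : probability Omega R) (K : finType) (S : K -> measurableType d')
    (X : forall k, Omega -> S k) : Prop :=
  forall (J : {set K}) (A : forall k, set (S k)),
    (forall k, measurable (A k)) ->
    P (\bigcap_(k in [set` J]) (X k @^-1` A k)) =
    (\prod_(k in J) fine (P (X k @^-1` A k)))%:E.

Section lsgt.
Variables (R : realType) (N p b : nat) (d : measure_display).
(* Xi n is the data space of agent n and D n the law of a data point in it. *)
Variables (Xi : 'I_N -> measurableType d) (D : forall n, probability (Xi n) R).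
Variable l : forall n, 'rV[R]_p -> Xi n -> R.

Definition local_objective n (y : 'rV[R]_p) : R := fine 'E_(D n)[l y].

Definition objective (y : 'rV[R]_p) : R :=
  N%:R^-1 * \sum_(n < N) local_objective n y.

Definition minibatch_gradient n (y : 'rV[R]_p) (I : b.-tuple (Xi n)) : 'rV[R]_p :=
  b%:R^-1 *: \sum_(i < b) gradient (fun z => l z (tnth I i)) y.

(* Row n of each matrix is the vector held by agent n. *)
Record lsgt_state := LsgtState {
  iter_y : 'M[R]_(N, p); (* models *)
  iter_v : 'M[R]_(N, p); (* trackers *)
  iter_g : 'M[R]_(N, p)  (* most recent mini-batch gradients *) }.

Variables (W : 'M[R]_N) (E : nat) (gamma : R) (y0 : 'rV[R]_p).

(* A realization of all mini-batches: I n 0 is the initial one of agent n, and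
   I n (r * E + q) with 1 <= q <= E is the one drawn at local step q of round
   r, so each index is used exactly once. *)
Variable I : forall n, nat -> b.-tuple (Xi n).

Definition all_gradients (k : nat) (Y : 'M[R]_(N, p)) : 'M[R]_(N, p) :=
  \matrix_(n < N) minibatch_gradient (row n Y) (I n k).

Definition lsgt_init : lsgt_state :=
  let Y := \matrix_(n < N) y0 in
  let G := all_gradients 0 Y in
  LsgtState Y G G.

Definition mix (s : lsgt_state) : lsgt_state :=
  LsgtState (W *m iter_y s) (W *m iter_v s) (iter_g s).

Definition local_step (k : nat) (s : lsgt_state) : lsgt_state :=
  let Y := iter_y s - gamma *: iter_v s in
  let G := all_gradients k Y in
  LsgtState Y (iter_v s + G - iter_g s) G.

Fixpoint local_updates (r q : nat) (s : lsgt_state) : lsgt_state :=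
  if q is q'.+1 then local_step (r * E + q) (local_updates r q' s) else mix s.

Fixpoint lsgt (r : nat) : lsgt_state :=
  if r is r'.+1 then local_updates r' E (lsgt r') else lsgt_init.

End lsgt.

(* Main.v *)
(* Round r is unrolled into E gradient steps; Z_{r,q} is the stacked iterate at
   which batch rE+q is evaluated, V_r the trackers and G_{r,q} the gradients.
   Then Z_{r,q} = W Z_{r,0} - gamma (q W V_r + sum_{j<q} (G_{r,j} - G_{r,0})) and
   V_{r+1} = W V_r + G_{r,E} - G_{r,0}, so gradient noise does not accumulate
   within a round, and the mean iterate follows z' = z - gamma mean(G).

   Since W - 11^T/N has norm lam < 1, Young's inequality with parameter
   mu/2, mu = 1 - lam^2, makes the consensus errors of Z and V contract by
   1 - mu/2 per round, up to the drift |Z_{r,q} - Z_{r,0}|^2.  Summed over the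
   rounds this is a linear feedback loop with gain of order
   (gamma E L)^2 / mu^4, and (iii) and (v) force gamma E L N <= (3/320) mu^2,
   so the loop closes.  The descent inequality for F along the mean iterate
   (the linear noise term vanishes because every batch is independent of the
   past, and averaging N independent noises divides the variance by N) bounds
   the averaged gradients, and E <= (T/N^5)^(1/3) turns the consensus terms, of
   order gamma^2 E^2 N, into order 1/sqrt(NET). *)

Require Import Defs.
From mathcomp Require Import ring lra measurable_realfun.

Set Implicit Arguments.
Unset Strict Implicit.
Unset Printing Implicit Defensive.

Local Open Scope classical_set_scope.
Local Open Scope ring_scope.

(** * Squared Frobenius norm and consensus error *)

(** The batch assumptions are stated at a fixed point, whereas the iterates are random. Transferring
    them needs joint measurability of a gradient in point and batch, obtained from measurability in
    the data and differentiability in the parameter, and independence of one batch from the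
    sigma-algebra of all the others, obtained from the finite product formula by a Dynkin argument;
    Tonelli and Fubini then freeze the iterate. The signed cross terms require square integrability
    of the iterates, which is carried along the rounds by induction. Within a round the argument is
    circular: the drift depends on gradient changes, which depend on the drift at earlier local
    steps. A bound uniform in [q] closes it, the fixed point of an affine map of slope 18 h with h =
    (gamma E L)^2. Since gamma > 0, (i) excludes lam = 0, and lam > 0 excludes N = 1. The resulting
    N >= 2 supplies two factors of 2: h / mu^4 <= (3/640)^2 and 2 (gamma E)^2 <= 1/sqrt(NET). The
    loop closes with room to spare, so its constants are read off the claim: 32 * 2577 and 3552 = 32
    * 111, where 32 = 2 * 16 and the 2 is paid by the last inequality. *)

Section squared_norm.
Variable R : realType.

Definition sqn m n (A : 'M[R]_(m, n)) : R := \sum_i \sum_j A i j ^+ 2.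

Definition mdot m n (A B : 'M[R]_(m, n)) : R := \sum_i \sum_j A i j * B i j.

Lemma sqn_ge0 m n (A : 'M[R]_(m, n)) : 0 <= sqn A.
Proof. by apply: sumr_ge0 => i _; apply: sumr_ge0 => j _; exact: sqr_ge0. Qed.

Lemma fnorm_sqr m n (A : 'M[R]_(m, n)) : fnorm A ^+ 2 = sqn A.
Proof. by rewrite sqr_sqrtr// sqn_ge0. Qed.

Lemma sqn0 m n : sqn (0 : 'M[R]_(m, n)) = 0.
Proof.
by rewrite /sqn big1// => i _; rewrite big1// => j _; rewrite mxE expr0n.
Qed.

Lemma sqn_eq0 m n (A : 'M[R]_(m, n)) : sqn A = 0 -> A = 0.
Proof.
move=> A0; apply/matrixP => i j; rewrite mxE.
have /psumr_eq0P H : \sum_i \sum_j A i j ^+ 2 = 0 by [].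
have /psumr_eq0P H2 := H (fun i _ => sumr_ge0 _ (fun j _ => sqr_ge0 (A i j))) i erefl.
have /eqP := H2 (fun j _ => sqr_ge0 (A i j)) j erefl.
by rewrite expf_eq0 => /eqP.
Qed.

Lemma sqnZ m n k (A : 'M[R]_(m, n)) : sqn (k *: A) = k ^+ 2 * sqn A.
Proof.
rewrite /sqn mulr_sumr; apply: eq_bigr => i _; rewrite mulr_sumr.
by apply: eq_bigr => j _; rewrite mxE exprMn.
Qed.

Lemma sqnN m n (A : 'M[R]_(m, n)) : sqn (- A) = sqn A.
Proof. by rewrite -scaleN1r sqnZ sqrrN expr1n mul1r. Qed.

Lemma sqnBC m n (A B : 'M[R]_(m, n)) : sqn (A - B) = sqn (B - A).
Proof. by rewrite -sqnN opprB. Qed.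

Lemma sqn_tr m n (A : 'M[R]_(m, n)) : sqn A^T = sqn A.
Proof.
rewrite /sqn exchange_big; apply: eq_bigr => i _.
by apply: eq_bigr => j _; rewrite mxE.
Qed.

Lemma sqn_row m n (A : 'M[R]_(m, n)) : sqn A = \sum_i sqn (row i A).
Proof.
by apply: eq_bigr => i _; rewrite /sqn big_ord1; apply: eq_bigr => j _; rewrite mxE.
Qed.

Lemma sqnDE m n (A B : 'M[R]_(m, n)) :
  sqn (A + B) = sqn A + 2 * mdot A B + sqn B.
Proof.
rewrite /sqn /mdot mulr_sumr -!big_split; apply: eq_bigr => i _ /=.
rewrite mulr_sumr -!big_split; apply: eq_bigr => j _ /=.
by rewrite mxE; ring.
Qed.

Lemma mdotZl m n k (A B : 'M[R]_(m, n)) : mdot (k *: A) B = k * mdot A B.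
Proof.
rewrite /mdot mulr_sumr; apply: eq_bigr => i _; rewrite mulr_sumr.
by apply: eq_bigr => j _; rewrite mxE mulrA.
Qed.

Lemma mdotC m n (A B : 'M[R]_(m, n)) : mdot A B = mdot B A.
Proof. by apply: eq_bigr => i _; apply: eq_bigr => j _; rewrite mulrC. Qed.

Lemma mdotZr m n k (A B : 'M[R]_(m, n)) : mdot A (k *: B) = k * mdot A B.
Proof. by rewrite mdotC mdotZl mdotC. Qed.

Lemma mdotDl m n (A B C : 'M[R]_(m, n)) : mdot (A + B) C = mdot A C + mdot B C.
Proof.
rewrite /mdot -big_split; apply: eq_bigr => i _; rewrite -big_split.
by apply: eq_bigr => j _; rewrite mxE mulrDl.
Qed.

Lemma mdotDr m n (A B C : 'M[R]_(m, n)) : mdot A (B + C) = mdot A B + mdot A C.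
Proof. by rewrite mdotC mdotDl mdotC (mdotC A C). Qed.

Lemma mdotvv m n (A : 'M[R]_(m, n)) : mdot A A = sqn A.
Proof. by apply: eq_bigr => i _; apply: eq_bigr => j _; rewrite expr2. Qed.

(** Expanding |cA - B|^2 >= 0 and dividing by c bounds the cross term, so neither Cauchy-Schwarz nor
    a square root is involved. *)
Lemma sqnD_young m n (c : R) (A B : 'M[R]_(m, n)) : 0 < c ->
  sqn (A + B) <= (1 + c) * sqn A + (1 + c^-1) * sqn B.
Proof.
move=> c0; have : 0 <= c ^+ 2 * sqn A - 2 * c * mdot A B + sqn B.
  have := sqn_ge0 (c *: A + - B).
  rewrite sqnDE sqnN sqnZ -(scaleN1r B) mdotZl mdotZr. by lra.
move=> H; have : 0 <= c^-1 * (c ^+ 2 * sqn A - 2 * c * mdot A B + sqn B).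
  by rewrite mulr_ge0// invr_ge0 ltW.
have -> : c^-1 * (c ^+ 2 * sqn A - 2 * c * mdot A B + sqn B) =
  c * sqn A - 2 * mdot A B + c^-1 * sqn B by field; rewrite gt_eqF.
by rewrite sqnDE; lra.
Qed.

Lemma sqnD_le m n (A B : 'M[R]_(m, n)) : sqn (A + B) <= 2 * sqn A + 2 * sqn B.
Proof. by have := @sqnD_young m n 1 A B ltr01; rewrite invr1. Qed.

Lemma sqnB_le m n (A B : 'M[R]_(m, n)) : sqn (A - B) <= 2 * sqn A + 2 * sqn B.
Proof. by have := sqnD_le A (- B); rewrite sqnN. Qed.

Lemma sqnD3_le m n (A B C : 'M[R]_(m, n)) :
  sqn (A + B + C) <= 3 * (sqn A + sqn B + sqn C).
Proof.
have := @sqnD_young m n 2 C (A + B) (ltr0Sn _ _).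
have := sqnD_le A B; rewrite (addrC C); lra.
Qed.

(** Expansion of |(A - B) + B/2|^2 >= 0. In the descent inequality [A] is the gradient of the
    averaged objective and [B] the mean of the agents' gradients, so that [A - B] is controlled by
    the consensus error. *)
Lemma mdot_ge m n (A B : 'M[R]_(m, n)) :
  3 / 4 * sqn B - sqn (A - B) <= mdot A B.
Proof.
have := sqn_ge0 ((A - B) + 2^-1 *: B).
rewrite sqnDE sqnZ mdotZr.
have -> : mdot (A - B) B = mdot A B - sqn B.
  by rewrite mdotDl -(scaleN1r B) mdotZl mdotvv mulN1r.
have -> : (2^-1 : R) ^+ 2 = 4^-1 by rewrite exprVn; congr (_^-1); ring.
lra.
Qed.

Lemma sqn_sum_le m n k (X : 'I_k -> 'M[R]_(m, n)) :
  sqn (\sum_(i < k) X i) <= k%:R * \sum_(i < k) sqn (X i).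
Proof.
elim: k X => [|k IH] X; first by rewrite !big_ord0 sqn0 mul0r.
rewrite !big_ord_recr /=; have := IH (fun i => X (widen_ord (leqnSn k) i)).
set S := \sum_(i < k) X _; set Q := \sum_(i < k) _; set Y := X ord_max => SQ.
case: k => [|k] in X IH S Q Y SQ *.
  by rewrite /S /Q !big_ord0 !add0r mul1r.
(* With parameter 1/(k+1) the factor (1 + 1/(k+1)) (k+1) of the earlier squares and the factor 1 +
   (k+1) of the last one are both k+2. *)
have := @sqnD_young m n k.+1%:R^-1 S Y; rewrite invr_gt0 ltr0n invrK => /(_ isT).
move=> /le_trans; apply.
have k0 : 0 <= 1 + k.+1%:R^-1 :> R by rewrite addr_ge0// invr_ge0.
have k2 : k.+2%:R = 1 + k.+1%:R :> R by rewrite -natr1 addrC.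
rewrite mulrDr k2 lerD2r.
apply: le_trans (ler_wpM2l k0 SQ) _.
by rewrite mulrA mulrDl mul1r mulVf ?pnatr_eq0// addrC.
Qed.

End squared_norm.

(** * Row means, consensus errors and mixing *)

Section consensus.
Variables (R : realType) (N p : nat).
Hypothesis N0 : (0 < N)%N.
Implicit Types (X Y : 'M[R]_(N, p)) (W : 'M[R]_N).

Let NR : N%:R != 0 :> R. Proof. by rewrite pnatr_eq0 -lt0n. Qed.

Definition consensus_error Y := Y - (const_mx 1 : 'cV[R]_N) *m row_mean Y.

Lemma row_meanE Y j : row_mean Y 0 j = N%:R^-1 * \sum_(n < N) Y n j.
Proof. by rewrite mxE summxE; congr (_ * _); apply: eq_bigr => n _; rewrite mxE. Qed.

Lemma row_meanD X Y : row_mean (X + Y) = row_mean X + row_mean Y.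
Proof.
by rewrite /row_mean -scalerDr -big_split; congr (_ *: _); apply: eq_bigr => i _;
  rewrite raddfD.
Qed.

Lemma row_meanZ k Y : row_mean (k *: Y) = k *: row_mean Y.
Proof.
rewrite /row_mean scalerA mulrC -scalerA; congr (_ *: _); rewrite scaler_sumr.
by apply: eq_bigr => i _; rewrite linearZ.
Qed.

Lemma row_meanB X Y : row_mean (X - Y) = row_mean X - row_mean Y.
Proof. by rewrite row_meanD -(scaleN1r Y) row_meanZ scaleN1r. Qed.

Lemma consensus_errorD X Y :
  consensus_error (X + Y) = consensus_error X + consensus_error Y.
Proof. by rewrite /consensus_error row_meanD mulmxDr opprD addrACA. Qed.

Lemma consensus_errorZ k Y : consensus_error (k *: Y) = k *: consensus_error Y.
Proof. by rewrite /consensus_error row_meanZ -scalemxAr scalerBr. Qed.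

Lemma consensus_errorB X Y :
  consensus_error (X - Y) = consensus_error X - consensus_error Y.
Proof.
by rewrite consensus_errorD -(scaleN1r Y) consensus_errorZ scaleN1r.
Qed.

Lemma const_mulmxE Y i j : ((const_mx 1 : 'M[R]_N) *m Y) i j = \sum_(n < N) Y n j.
Proof. by rewrite mxE; apply: eq_bigr => n _; rewrite mxE mul1r. Qed.

Lemma mean_mxE Y :
  (const_mx 1 : 'cV[R]_N) *m row_mean Y = N%:R^-1 *: (const_mx 1 *m Y).
Proof.
apply/matrixP => i j; rewrite [RHS]mxE const_mulmxE mxE big_ord1 row_meanE mxE.
by rewrite mul1r.
Qed.

(** Pythagoras, column by column: deviations from the mean sum to zero, which kills the cross term.
    Jensen's inequality for row means is one half of it. *)
Lemma sqn_consensus_split Y :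
  sqn Y = sqn (consensus_error Y) + N%:R * sqn (row_mean Y).
Proof.
rewrite /sqn big_ord1 exchange_big [X in _ = X + _]exchange_big mulr_sumr -big_split.
apply: eq_bigr => j _ /=; set m := row_mean Y 0 j.
transitivity (\sum_(n < N) ((Y n j - m) ^+ 2 + (2 * m * (Y n j - m) + m ^+ 2))).
  by apply: eq_bigr => n _; ring.
rewrite big_split big_split /= sumr_const card_ord -mulr_sumr sumrB sumr_const card_ord.
have -> : \sum_(n < N) Y n j = m *+ N.
  by rewrite -[RHS]mulr_natl /m row_meanE mulrA divff// mul1r.
rewrite subrr mulr0 add0r mulr_natl; congr (_ + _).
by apply: eq_bigr => n _; rewrite !mxE big_ord1 mxE mul1r.
Qed.

Lemma sqn_consensus_error_le Y : sqn (consensus_error Y) <= sqn Y.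
Proof. by rewrite (sqn_consensus_split Y) lerDl mulr_ge0// sqn_ge0. Qed.

Lemma sqn_row_mean_le Y : N%:R * sqn (row_mean Y) <= sqn Y.
Proof. by rewrite (sqn_consensus_split Y) lerDr sqn_ge0. Qed.

Variable W : 'M[R]_N.
Hypothesis W1 : W *m (const_mx 1 : 'cV[R]_N) = const_mx 1.
Hypothesis W2 : (const_mx 1 : 'rV[R]_N) *m W = const_mx 1.

Lemma row_mean_mix Y : row_mean (W *m Y) = row_mean Y.
Proof.
apply/rowP => j; rewrite !row_meanE; congr (_ * _).
under eq_bigr do rewrite mxE.
rewrite exchange_big; apply: eq_bigr => k _ /=; rewrite -mulr_suml.
suff -> : \sum_i W i k = 1 by rewrite mul1r.
have /matrixP/(_ 0 k) := W2; rewrite !mxE => <-.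
by apply: eq_bigr => i _; rewrite mxE mul1r.
Qed.

(** With J = 11^T/N one has (W - J) 1 = 0, so W - J acts alike on [Y] and on its consensus error,
    and J Y is the stacked mean, which mixing preserves. *)
Lemma consensus_error_mix Y :
  consensus_error (W *m Y) = (W - N%:R^-1 *: const_mx 1) *m consensus_error Y.
Proof.
rewrite /consensus_error row_mean_mix mulmxBr mulmxBl mulmxA mulmxBl W1.
rewrite -scalemxAl -mean_mxE -scalemxAl.
suff -> : N%:R^-1 *: (const_mx 1 *m (const_mx 1 : 'cV[R]_N)) = const_mx 1 :> 'cV[R]_N.
  by rewrite subrr mul0mx subr0.
apply/matrixP => i j; rewrite !mxE.
under eq_bigr do rewrite !mxE mulr1.
by rewrite sumr_const card_ord mulVf.
Qed.

Lemma mix_subr Y : W *m Y - Y = W *m consensus_error Y - consensus_error Y.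
Proof.
by rewrite /consensus_error mulmxBr mulmxA W1 opprB addrA subrK.
Qed.

(** The displacement caused by mixing involves only the disagreement between agents; hence the drift
    can be measured from the iterate before mixing. *)
Lemma mix_subrE Y : W *m Y - Y =
  (W - N%:R^-1 *: const_mx 1) *m consensus_error Y - consensus_error Y.
Proof.
by rewrite -consensus_error_mix -consensus_errorB mix_subr /consensus_error
  row_meanB row_mean_mix subrr mulmx0 subr0 -mix_subr.
Qed.

End consensus.

(** * The largest singular value as an operator norm *)

Lemma continuous_sumT (R : realType) (T : topologicalType) (I : Type) (r : seq I)
    (F : I -> T -> R) :
  (forall i, continuous (F i)) -> continuous (fun x => \sum_(i <- r) F i x).
Proof.
move=> cF; elim: r => [|i r IH].
  by under eq_fun do rewrite big_nil; exact: cst_continuous.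
under eq_fun do rewrite big_cons.
by move=> x; apply: continuousD; [exact: cF|exact: IH].
Qed.

Lemma continuous_sqn (R : realType) (T : topologicalType) m n (f : T -> 'M[R]_(m, n)) :
  (forall i j, continuous (fun x => f x i j)) -> continuous (fun x => sqn (f x)).
Proof.
move=> cf; apply: continuous_sumT => i; apply: continuous_sumT => j x.
by under eq_fun do rewrite expr2; apply: continuousM; exact: cf.
Qed.

Lemma mdot_mulmxl (R : realType) m n k (X : 'M[R]_(m, n)) (A : 'M[R]_(n, k))
    (Y : 'M[R]_(m, k)) : mdot (X *m A) Y = mdot X (Y *m A^T).
Proof.
have mdotE a b (C D : 'M[R]_(a, b)) : mdot C D = \tr (C *m D^T).
  apply: eq_bigr => i _; rewrite mxE; apply: eq_bigr => j _; by rewrite mxE.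
by rewrite !mdotE trmx_mul trmxK mulmxA.
Qed.

Section operator_norm.
Variables (R : realType) (N : nat).
Hypothesis N0 : (0 < N)%N.
Variable A : 'M[R]_N.

Let q (x : 'rV[R]_N) : R := sqn (x *m A^T).

Let sphere : set 'rV[R]_N := [set x | sqn x = 1].

Let coord_mul i j : continuous (fun x : 'rV[R]_N => (x *m A^T) i j).
Proof.
under eq_fun do rewrite mxE.
apply: continuous_sumT => k x.
by apply: continuousM; [exact: coord_continuous|exact: cst_continuous].
Qed.

Let compact_sphere : compact sphere.
Proof.
apply: bounded_closed_compact; last first.
  rewrite (_ : sphere = (fun x => sqn x) @^-1` [set 1])//.
  apply: preimage_closed; last exact: closed_eq.
  by move=> x _; apply: continuous_sqn => i j; exact: coord_continuous.
exists 1; split; first exact: num_real.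
move=> M M1 x /= x1; apply: le_trans (ltW M1); change (mx_norm x <= 1); rewrite mx_normrE.
apply/bigmax_leP; split=> // -[i j] _ /=.
rewrite -(@ler_pXn2r _ 2)// ?nnegrE// real_normK ?num_real// expr1n -x1 /sqn.
rewrite (bigD1 i)//= (bigD1 j)//= -addrA lerDl addr_ge0//.
  by apply: sumr_ge0 => k _; exact: sqr_ge0.
by apply: sumr_ge0 => k _; apply: sumr_ge0 => ? _; exact: sqr_ge0.
Qed.

Let sphere_max : exists2 x0, sqn x0 = 1 & forall x, q x <= q x0 * sqn x.
Proof.
have [||x0] := @compact_EVT_max _ _ q sphere _ compact_sphere.
- exists (delta_mx 0 (Ordinal N0)); rewrite /sphere /= /sqn big_ord1.
  rewrite (bigD1 (Ordinal N0))//= mxE !eqxx expr1n big1 ?addr0// => j jN.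
  by rewrite mxE (negbTE jN) andbF expr0n.
- by apply: continuous_subspaceT; exact: continuous_sqn.
rewrite inE => x01 maxq; exists x0 => // x.
have [x_0|x_0] := eqVneq x 0.
  by rewrite x_0 /q mul0mx !sqn0 mulr0.
have s0 : 0 < sqn x.
  by rewrite lt_def sqn_ge0 andbT; apply: contra_neq x_0 => /sqn_eq0.
pose y := (Num.sqrt (sqn x))^-1 *: x.
have y1 : y \in sphere.
  by rewrite inE /sphere /= sqnZ exprVn sqr_sqrtr ?sqn_ge0// mulVf// gt_eqF.
have := maxq _ y1; rewrite /q -scalemxAl sqnZ exprVn sqr_sqrtr ?sqn_ge0//.
by rewrite mulrC ler_pdivrMr.
Qed.

(** The supremum over eigenvalues has to be tied to the operator norm. A maximizer [x0] of |x A^T|^2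
    on the compact unit sphere is shown to be an eigenvector of A^T A by a first-variation argument;
    its value M is then an eigenvalue and bounds all others. *)
Lemma largest_singular_value_spec : 0 <= largest_singular_value A /\
  exists2 x0 : 'rV[R]_N, sqn x0 = 1 & largest_singular_value A ^+ 2 = sqn (x0 *m A^T) /\
    forall x : 'rV_N, sqn (x *m A^T) <= largest_singular_value A ^+ 2 * sqn x.
Proof.
have [x0 x01 maxq] := sphere_max.
set M := q x0 in maxq.
have M0 : 0 <= M by exact: sqn_ge0.
pose e := x0 *m (A^T *m A) - M *: x0.
have e0 : e = 0.
  apply: sqn_eq0; apply/eqP; rewrite eq_le sqn_ge0 andbT.
  (* Maximality tested at [x0 + t *: e], where [e] is the residual of the eigenvalue equation. The
     first-order gain 2t|e|^2 is at most t^2 M |e|^2, and t = 1/M (or t = 1 if M = 0) forces e =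
     0. *)
  have key t : 0 < t -> 2 * sqn e <= t * (M * sqn e).
    move=> t0; have := maxq (x0 + t *: e).
    rewrite /q mulmxDl sqnDE -scalemxAl mdotZr sqnDE x01 sqnZ sqnZ mdotZr.
    have -> : mdot (x0 *m A^T) (e *m A^T) = sqn e + M * mdot x0 e.
      rewrite mdotC mdot_mulmxl trmxK -mulmxA mdotC.
      by rewrite -mdotvv -mdotZl -mdotDl /e subrK.
    have := mulr_ge0 (sqr_ge0 t) (sqn_ge0 (e *m A^T)) => qe; rewrite (_ : sqn (x0 *m A^T) = M)// => H.
    have : t * (2 * sqn e) <= t * (t * (M * sqn e)) by lra.
    by rewrite ler_pM2l.
  rewrite leNgt; apply/negP => e_gt0.
  have [M_0|M_0] := eqVneq M 0.
    by have := key 1 ltr01; rewrite M_0; lra.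
  have := key M^-1; rewrite invr_gt0 lt_def M_0 M0 => /(_ isT).
  by rewrite mulrA mulVf//; lra.
have eigM : eigenvalue (A^T *m A) M.
  apply/eigenvalueP; exists x0; first by apply/eqP; rewrite -subr_eq0 -/e e0.
  by apply/eqP => x00; move: x01; rewrite x00 sqn0 => /esym/eqP; rewrite oner_eq0.
have ubM : ubound (singular_value A) (Num.sqrt M).
  move=> _ [a /eigenvalueP[v va v0] <-]; rewrite ler_sqrt//.
  have s0 : 0 < sqn v.
    by rewrite lt_def sqn_ge0 andbT; apply: contra_neq v0 => /sqn_eq0.
  rewrite -(ler_pM2r s0); suff <- : q v = a * sqn v by exact: maxq.
  by rewrite /q -mdotvv mdot_mulmxl trmxK -mulmxA va mdotZr mdotvv.
have -> : largest_singular_value A = Num.sqrt M.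
  apply/eqP; rewrite eq_le; apply/andP; split.
    by apply: ge_sup => //; exists (Num.sqrt M); exists M.
  by apply: (ub_le_sup (ex_intro _ _ ubM)); exists M.
split; first exact: sqrtr_ge0.
by exists x0 => //; rewrite sqr_sqrtr.
Qed.

Lemma sqn_mulmx_le p (X : 'M[R]_(N, p)) :
  sqn (A *m X) <= largest_singular_value A ^+ 2 * sqn X.
Proof.
have [_ [_ _ [_ H]]] := largest_singular_value_spec.
rewrite -(sqn_tr (A *m X)) -(sqn_tr X) trmx_mul sqn_row (sqn_row X^T) mulr_sumr.
by apply: ler_sum => i _; rewrite row_mul.
Qed.

End operator_norm.

(** * Gradients and the descent inequality *)

Section smooth.
Variables (R : realType) (p : nat).

Lemma derive_gradient (f : 'rV[R]_p -> R) (y v : 'rV[R]_p) :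
  differentiable f y -> 'D_v f y = mdot (gradient f y) v.
Proof.
move=> df; rewrite deriveE// {1}[v]row_sum_delta linear_sum /mdot big_ord1.
by apply: eq_bigr => i _; rewrite linearZ mxE deriveE// mulrC.
Qed.

(** The mean value theorem gives the increment as the inner product of [v] with a gradient at an
    intermediate point; the Lipschitz bound over the whole segment yields the factor L, instead of
    the L/2 that integration along the segment would give. *)
Lemma descent_lemma (f : 'rV[R]_p -> R) (L : R) (y v : 'rV[R]_p) : 0 < L ->
  (forall y, differentiable f y) ->
  (forall y y', sqn (gradient f y - gradient f y') <= L ^+ 2 * sqn (y - y')) ->
  f (y + v) <= f y + mdot (gradient f y) v + L * sqn v.
Proof.
move=> L0 df lipf.
pose g (t : R) := f (t *: v + y).
have dg (t : R) : is_derive t (1 : R) g (mdot (gradient f (t *: v + y)) v).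
  have E (h : R) : h^-1 *: (g (h *: 1 + t) - g t) =
             h^-1 *: (f (h *: v + (t *: v + y)) - f (t *: v + y)).
    by rewrite /g scalerDl -scalerA scale1r addrA.
  have dv : derivable f (t *: v + y) v by exact: diff_derivable.
  apply: DeriveDef.
    rewrite /derivable; under eq_fun do rewrite E; exact: dv.
  by rewrite -derive_gradient// /derive; under eq_fun do rewrite E.
have [|c /andP[c0 c1]] := @MVT R g _ 0 1 ltr01 (fun t _ => dg t).
  apply: continuous_subspaceT => t; apply: differentiable_continuous.
  by apply/derivable1_diffP; case: (dg t).
rewrite /g scale1r scale0r add0r subr0 mulr1 (addrC v) => /eqP; rewrite subr_eq => /eqP ->.
rewrite -{1}[gradient f (_ + _)](subrK (gradient f y)) mdotDl.
set a := gradient _ _ - _.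
have sa : sqn a <= L ^+ 2 * sqn v.
  apply: le_trans (lipf _ _) _; rewrite addrK sqnZ ler_wpM2l ?sqr_ge0//.
  by rewrite ler_piMl ?sqn_ge0// exprn_ile1// ltW.
suff : mdot a v <= L * sqn v by lra.
(* 2L<a,v> <= |a|^2 + L^2 |v|^2 <= 2 L^2 |v|^2, then division by 2L. *)
have := sqn_ge0 (a - L *: v).
rewrite sqnDE sqnN sqnZ -(scaleNr L) mdotZr => H.
have : 2 * L * mdot a v <= 2 * L * (L * sqn v) by lra.
by rewrite ler_pM2l// mulr_gt0.
Qed.

End smooth.

(** * Smoothness of the averaged objective *)

Section average_objective.
Variables (R : realType) (N p : nat) (f : 'I_N -> 'rV[R]_p -> R) (L : R).
Hypotheses (N0 : (0 < N)%N) (L0 : 0 < L).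
Hypothesis df : forall n y, differentiable (f n) y.
Hypothesis f_lip : forall n y y',
  sqn (gradient (f n) y - gradient (f n) y') <= L ^+ 2 * sqn (y - y').

Let F y := N%:R^-1 * \sum_(n < N) f n y.

Definition agent_gradients (Z : 'M[R]_(N, p)) : 'M[R]_(N, p) :=
  \matrix_(n < N) gradient (f n) (row n Z).

Lemma agent_gradients_lip Z Z' :
  sqn (agent_gradients Z - agent_gradients Z') <= L ^+ 2 * sqn (Z - Z').
Proof.
rewrite sqn_row (sqn_row (Z - Z')) mulr_sumr; apply: ler_sum => n _.
by rewrite !linearB /= !rowK f_lip.
Qed.

Lemma row_mean_agent_gradients Z :
  row_mean (agent_gradients Z) = N%:R^-1 *: \sum_(n < N) gradient (f n) (row n Z).
Proof. by rewrite /row_mean; under eq_bigr do rewrite rowK. Qed.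

Lemma differentiable_average y : differentiable F y.
Proof.
apply: differentiableM; first exact: differentiable_cst.
rewrite (_ : (fun x => _) = \sum_(n < N) f n).
  by apply: differentiable_sum => n; exact: df.
by apply/funext => x; rewrite fct_sumE.
Qed.

(** Written through the stack with all rows equal to [y], differences of gradients of [F] become row
    means of differences of [agent_gradients], so that Jensen and the Lipschitz bound apply to
    them. *)
Lemma gradient_average y :
  gradient F y = row_mean (agent_gradients ((const_mx 1 : 'cV[R]_N) *m y)).
Proof.
rewrite row_mean_agent_gradients.
have -> : \sum_(n < N) gradient (f n) (row n ((const_mx 1 : 'cV[R]_N) *m y)) =
          \sum_(n < N) gradient (f n) y.
  apply: eq_bigr => n _; congr gradient; apply/rowP => j.
  by rewrite !mxE big_ord1 mxE mul1r.
apply/rowP => j; rewrite !mxE summxE.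
have dd n : derivable (f n) y (delta_mx 0 j) by exact: diff_derivable.
have -> : F = N%:R^-1 \*: (\sum_(n < N) f n).
  by apply/funext => x; rewrite /F fct_sumE.
rewrite deriveZ; last exact: derivable_sum.
rewrite derive_sum//; congr (_ * _).
by apply: eq_bigr => n _; rewrite mxE.
Qed.

(** Both gradients are row means of [agent_gradients], one at the stacked mean and one at [Z]; the
    distance between these two stacks is the consensus error. The factor N is the gain of Jensen's
    inequality. *)
Lemma gradient_gap Z : N%:R *
  sqn (gradient F (row_mean Z) - row_mean (agent_gradients Z))
  <= L ^+ 2 * sqn (consensus_error Z).
Proof.
rewrite gradient_average -row_meanB.
apply: le_trans (sqn_row_mean_le N0 _) _; apply: le_trans (agent_gradients_lip _ _) _.
by rewrite ler_wpM2l ?sqr_ge0// sqnBC.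
Qed.

Lemma gradient_average_lip y y' :
  sqn (gradient F y - gradient F y') <= L ^+ 2 * sqn (y - y').
Proof.
have NR : 0 < N%:R :> R by rewrite ltr0n.
rewrite -(ler_pM2l NR) !gradient_average -row_meanB.
apply: le_trans (sqn_row_mean_le N0 _) _; apply: le_trans (agent_gradients_lip _ _) _.
rewrite mulrCA -mulmxBr; apply: ler_wpM2l; first exact: sqr_ge0.
rewrite sqn_row; apply: (@le_trans _ _ (\sum_(n < N) sqn (y - y'))).
  apply: ler_sum => n _; rewrite (_ : row n _ = y - y')//.
  by apply/rowP => j; rewrite mxE mxE big_ord1 mxE mul1r.
by rewrite sumr_const card_ord mulr_natl.
Qed.

Lemma descent_average y v : F (y + v) <= F y + mdot (gradient F y) v + L * sqn v.
Proof.
apply: descent_lemma => //; first exact: differentiable_average.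
exact: gradient_average_lip.
Qed.

End average_objective.

(** * Joint measurability of parametrized gradients *)

Section caratheodory.
Context {R : realType} {d dX : measure_display}.
Variables (T : measurableType d) (X : measurableType dX) (p : nat).

Definition measurable_mx m n (Y : T -> 'M[R]_(m, n)) :=
  forall i j, measurable_fun setT (fun t => Y t i j).

(** Splitting along the countably many values of [k] replaces the random index by a constant on each
    piece. *)
Lemma measurable_fun_countable_glue (C : countType) (k : T -> C) (g : C -> T -> R) :
  (forall c, measurable (k @^-1` [set c])) ->
  (forall c, measurable_fun setT (g c)) ->
  measurable_fun setT (fun t => g (k t) t).
Proof.
move=> mk mg _ B mB; rewrite setTI.
rewrite (_ : _ @^-1` B = \bigcup_c (k @^-1` [set c] `&` g c @^-1` B)).
  apply: countable_bigcupT_measurable => // c; apply: measurableI => //.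
  by rewrite -[X in measurable X]setTI; exact: mg.
apply/seteqP; split=> [t Bt|t [c _ [<-]]//].
by exists (k t).
Qed.

Lemma measurable_floor_fiber (f : T -> R) (k : int) : measurable_fun setT f ->
  measurable [set t | Num.floor (f t) = k].
Proof.
move=> mf.
rewrite (_ : [set _ | _] = f @^-1` `[k%:~R, (k + 1)%:~R[%classic).
  by rewrite -[X in measurable X]setTI; exact: mf.
apply/seteqP; split=> t /=; rewrite in_itv /= -floor_eq => /eqP//.
Qed.

Let grid (m : nat) (v : {ffun 'I_p -> int}) : 'rV[R]_p :=
  \row_j ((v j)%:~R / m.+1%:R).

Let grid_index m (y : 'rV[R]_p) : {ffun 'I_p -> int} :=
  [ffun j => Num.floor (y 0 j * m.+1%:R)].

Let grid_cvg y : grid m (grid_index m y) @[m --> \oo] --> y.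
Proof.
apply/cvgrPdist_le => e e0; near=> m.
have me : m.+1%:R^-1 <= e by near: m; have := near_infty_natSinv_lt (PosNum e0); apply: filterS => k /= /ltW.
change (mx_norm (y - grid m (grid_index m y)) <= e); rewrite mx_normrE.
apply/bigmax_leP; split; first exact: ltW.
move=> [i j] _; rewrite !mxE /= ffunE ord1.
apply: le_trans me; have m0 : 0 < m.+1%:R :> R by rewrite ltr0n.
have /andP[f1 f2] := floor_itv (y 0 j * m.+1%:R).
rewrite intrD in f2.
set k := Num.floor _ in f1 f2 *.
rewrite (_ : _ - _ = (y 0 j * m.+1%:R - k%:~R) / m.+1%:R); last first.
  by field; rewrite gt_eqF.
rewrite normrM normfV (gtr0_norm m0) ler_piMl ?invr_ge0 ?(ltW m0)//.
by rewrite ler_norml; apply/andP; split; lra.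
Unshelve. all: by end_near. Qed.

(** A Caratheodory argument: the random point is rounded down to a grid of mesh 1/(m+1), which takes
    countably many values, and continuity in the point lets m tend to infinity. *)
Lemma measurable_caratheodory (h : 'rV[R]_p -> X -> R) (Y : T -> 'rV[R]_p) (Z : T -> X) :
  (forall y, measurable_fun setT (h y)) -> (forall x, continuous (h ^~ x)) ->
  measurable_mx Y -> measurable_fun setT Z ->
  measurable_fun setT (fun t => h (Y t) (Z t)).
Proof.
move=> mh ch mY mZ.
apply: (@measurable_fun_cvg _ _ _ _
  (fun m t => h (grid m (grid_index m (Y t))) (Z t))); last first.
  by move=> t _; exact: (cvg_comp _ _ (@grid_cvg (Y t)) (@ch (Z t) (Y t))).
move=> m.
apply: (@measurable_fun_countable_glue _ (fun t => grid_index m (Y t))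
  (fun c t => h (grid m c) (Z t))); last first.
  by move=> c; exact: (measurableT_comp (mh (grid m c)) mZ).
suff H (c : {ffun 'I_p -> int}) :
    measurable [set t | grid_index m (Y t) = c] by move=> c; exact: H.
rewrite (_ : [set t | _] =
  \bigcap_(j in [set: 'I_p]) [set t | Num.floor (Y t 0 j * m.+1%:R) = c j]).
  apply: fin_bigcap_measurable => // j _; apply: measurable_floor_fiber.
  by apply: measurable_funM => //; exact: mY.
apply/seteqP; split=> [t /= <- j _|t /= H].
  by rewrite /grid_index ffunE.
by apply/ffunP => j; rewrite /grid_index ffunE; exact: H.
Qed.

End caratheodory.

Section measurable_gradient.
Context {R : realType} {d dX : measure_display}.
Variables (T : measurableType d) (X : measurableType dX) (p : nat).

(** Each partial derivative is a pointwise limit of difference quotients along the steps 1/(m+1),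
    and every quotient is measurable by [measurable_caratheodory]. *)
Lemma measurable_gradient_param (h : 'rV[R]_p -> X -> R) (Y : T -> 'rV[R]_p)
    (Z : T -> X) :
  (forall y, measurable_fun setT (h y)) ->
  (forall x y, differentiable (h ^~ x) y) ->
  measurable_mx Y -> measurable_fun setT Z ->
  measurable_mx (fun t => gradient (h ^~ (Z t)) (Y t)).
Proof.
move=> mh dh mY mZ i0 i; under eq_fun do rewrite mxE.
have ch x : continuous (h ^~ x).
  by move=> y; apply: differentiable_continuous; exact: dh.
apply: (@measurable_fun_cvg _ _ _ _
  (fun m t => m.+1%:R^-1^-1 *
    (h (m.+1%:R^-1 *: delta_mx 0 i + Y t) (Z t) - h (Y t) (Z t)))).
  move=> m; apply: measurable_funM => //; apply: measurable_funB.
    apply: measurable_caratheodory => // a b.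
    by under eq_fun do rewrite mxE; apply: measurable_funD => //; exact: mY.
  exact: measurable_caratheodory.
move=> t _.
have dv : derivable (h ^~ (Z t)) (Y t) (delta_mx 0 i).
  by apply: diff_derivable; exact: dh.
have /cvgr_dnbhsP/(_ (fun m => m.+1%:R^-1)) := dv.
apply; split; last exact: cvg_harmonic.
by move=> n; rewrite invr_eq0.
Qed.

End measurable_gradient.

(** * Independence from all the other samples *)

Section complementary_events.
Context {d d' : measure_display} {Omega : measurableType d} {R : realType}.
Variables (P : probability Omega R) (K : finType) (S : K -> measurableType d').
Variable X : forall k, Omega -> S k.
Hypothesis mX : forall k, measurable_fun setT (X k).
Hypothesis indepX : mutually_independent P X.
Variable k0 : K.

(** Cylinder events on all samples but [k0]. They form a pi-system, which is the shape that the
    Dynkin induction needs. *)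
Definition other_events : set (set Omega) :=
  [set A | exists B : forall k, set (S k), (forall k, measurable (B k)) /\
    A = \bigcap_(k in [set` [set~ k0]%SET]) (X k @^-1` B k)].

Let mpre k (B : set (S k)) : measurable B -> measurable (X k @^-1` B).
Proof. by move=> mB; rewrite -[X in measurable X]setTI; exact: mX. Qed.

Lemma measurable_other_events (A : set Omega) : <<s other_events >> A -> measurable A.
Proof.
suff : <<s other_events >> `<=` measurable by exact.
apply: smallest_sub; first exact: sigma_algebra_measurable.
move=> _ [B [mB ->]]; apply: fin_bigcap_measurable => // k _; exact: mpre.
Qed.

Lemma measurable_fun_other (k : K) : k != k0 ->
  measurable_fun (setT : set (g_sigma_algebraType other_events)) (X k).
Proof.
move=> kk0 _ B mB; rewrite setTI; apply: sub_sigma_algebra.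
(* The cylinder whose only constrained coordinate is [k]; it is an admissible one because [k]
   differs from [k0]. *)
exists (@eqtype.dfwith K (fun j => set (S j)) (fun j => [set: S j]) k B); split.
  by move=> j; case: eqtype.dfwithP.
apply/seteqP; split=> [t /= Bt j _ /=|t /= H]; first by case: eqtype.dfwithP.
have := H k; rewrite /= dfwith_in; apply.
by rewrite /= !inE.
Qed.

(** The events satisfying the product formula with [C] are closed under complement and disjoint
    countable union, and contain the cylinders, so the pi-lambda theorem covers the generated
    sigma-algebra. *)
Lemma indep_other_events (A : set Omega) (B : set (S k0)) :
  <<s other_events >> A -> measurable B ->
  P (A `&` X k0 @^-1` B) = (P A * P (X k0 @^-1` B))%E.
Proof.
move=> + mB; set C := X k0 @^-1` B.
have mC : measurable C by exact: mpre.
have PCfin : P C \is a fin_num by exact: fin_num_measure.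
move: A; apply: (@dynkin_induction _ (g_sigma_algebraType other_events) other_events
  (fun A => P (A `&` C) = (P A * P C)%E)) => //.
- move=> _ _ [B1 [mB1 ->]] [B2 [mB2 ->]].
  exists (fun k => B1 k `&` B2 k); split; first by move=> k; exact: measurableI.
  apply/seteqP; split=> [t [H1 H2] k Hk|t H]; first by split; [exact: H1|exact: H2].
  by split=> k Hk; case: (H k Hk).
- by rewrite setTI probability_setT mul1e.
- move=> _ [B' [mB' ->]].
  (* [B'] with its value at [k0] replaced by [B]: the intersection becomes a full cylinder, and the
     independence hypothesis is applied once to all indices and once to those other than [k0]. *)
  pose B1 := @eqtype.dfwith K (fun j => set (S j)) B' k0 B.
  have mB1 k : measurable (B1 k) by rewrite /B1; case: eqtype.dfwithP.
  have eqT : \bigcap_(k in [set` [set~ k0]%SET]) (X k @^-1` B' k) `&` C =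
      \bigcap_(k in [set` [set: K]%SET]) (X k @^-1` B1 k).
    apply/seteqP; split=> [t [H Ct] k _ /=|t H].
      rewrite /B1; case: eqtype.dfwithP => // j kj; apply: H.
      by rewrite /= in_setC1 eq_sym.
    split=> [k /= kk0|].
      have := H k; rewrite /= /B1 dfwith_out; first by apply; rewrite finset.in_setT.
      by move: kk0; rewrite in_setC1 eq_sym.
    by have := H k0; rewrite /= /B1 dfwith_in; apply; rewrite finset.in_setT.
  rewrite eqT indepX// [X in _ = (X * _)%E]indepX// (bigD1 k0)//= {1}/B1 dfwith_in.
  rewrite EFinM fineK// muleC; congr (_%:E * _)%E.
  rewrite (eq_bigl (fun k => k != k0)); last by move=> k; rewrite finset.in_setT.
  rewrite [in RHS](eq_bigl (fun k => k != k0)); last by move=> k; rewrite in_setC1.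
  apply: eq_bigr => k kk0.
  by rewrite /B1 dfwith_out// eq_sym.
- move=> A mA PA.
  have mA' : measurable (A : set Omega) by exact: measurable_other_events.
  have -> : ~` A `&` C = C `\` A by rewrite setDE setIC.
  rewrite measureD//; last by rewrite ltey_eq PCfin.
  have PCA : P (C `&` A) = (P A * P C)%E by rewrite setIC.
  transitivity (P C - P A * P C)%E; first by congr (_ - _)%E.
  by rewrite probability_setC// muleBl// mul1e.
- move=> F mF tF PF.
  have mF' n : measurable (F n : set Omega) by exact: (measurable_other_events (mF n)).
  rewrite setI_bigcupl !measure_bigcup//; last 2 first.
  + by move=> i _; exact: measurableI.
  + by apply: trivIset_setIr.
  rewrite muleC -(fineK PCfin) -nneseriesZl//.
  apply: eq_eseriesr => i _.
  by rewrite fineK// muleC; exact: PF.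
Qed.

End complementary_events.

(** * Integrating out one of two independent variables *)

Section independent_pair.
Context {d d1 d2 : measure_display} {Omega : measurableType d} {R : realType}.
Variables (P : probability Omega R) (T1 : measurableType d1) (T2 : measurableType d2).
Variables (Y : {mfun Omega >-> T1}) (Z : {mfun Omega >-> T2}).
Hypothesis indep : forall A B, measurable A -> measurable B ->
  P (Y @^-1` A `&` Z @^-1` B) = (P (Y @^-1` A) * P (Z @^-1` B))%E.

Let YZ := fun w => (Y w, Z w).

Let mYZ : measurable_fun setT YZ.
Proof. exact: measurable_fun_pair. Qed.

Let joint : {mfun Omega >-> (T1 * T2)%type} := mfun_Sub (mem_set mYZ).

Let jointE A : measurable A ->
  (distribution P Y \x distribution P Z)%E A = distribution P joint A.
Proof.
by apply: product_measure_unique => B C mB mC; exact: indep.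
Qed.

(** Independence says that the joint law agrees with the product law on rectangles, hence
    everywhere; Tonelli then freezes [Y]. *)
Lemma indep_tonelli (f : T1 * T2 -> \bar R) : measurable_fun setT f ->
  (forall x, 0 <= f x)%E ->
  (\int[P]_w f (Y w, Z w) = \int[P]_w \int[P]_w' f (Y w, Z w'))%E.
Proof.
move=> mf f0.
have -> : (\int[P]_w f (Y w, Z w) = \int[distribution P joint]_x f x)%E.
  by rewrite ge0_integral_distribution.
rewrite (eq_measure_integral (distribution P Y \x distribution P Z)%E); last first.
  by move=> A mA _; first [exact: jointE|exact/esym/jointE].
rewrite fubini_tonelli1// ge0_integral_distribution//; last 2 first.
- exact: measurable_fun_fubini_tonelli_F.
- by move=> y; apply: integral_ge0.
apply: eq_integral => w _ /=; rewrite /fubini_F ge0_integral_distribution//.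
exact: measurableT_comp.
Qed.

(** The signed counterpart. Sections are integrable at every [y], so the inner integral can be moved
    between the law of [Z] and [P] pointwise. *)
Lemma indep_fubini (f : T1 * T2 -> R) : measurable_fun setT f ->
  P.-integrable setT (fun w => (f (Y w, Z w))%:E) ->
  (forall y, P.-integrable setT (fun w => (f (y, Z w))%:E)) ->
  (\int[P]_w (f (Y w, Z w))%:E = \int[P]_w \int[P]_w' (f (Y w, Z w'))%:E)%E.
Proof.
move=> mf intf intf2.
have mEf : measurable_fun setT (EFin \o f) by exact/measurable_EFinP.
have int_joint : (distribution P Y \x distribution P Z)%E.-integrable setT (EFin \o f).
  apply/integrableP; split => //.
  rewrite (eq_measure_integral (distribution P joint)); last first.
    by move=> A mA _; first [exact: jointE|exact/esym/jointE].
  rewrite ge0_integral_distribution//; last exact: measurableT_comp.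
  by case/integrableP : intf.
have -> : (\int[P]_w (f (Y w, Z w))%:E = \int[distribution P joint]_x (f x)%:E)%E.
  by rewrite integral_distribution.
rewrite (eq_measure_integral (distribution P Y \x distribution P Z)%E); last first.
  by move=> A mA _; first [exact: jointE|exact/esym/jointE].
rewrite -integral12_prod_meas1// /fubini_F.
have E y : (\int[distribution P Z]_z (f (y, z))%:E = \int[P]_w' (f (y, Z w'))%:E)%E.
  rewrite integral_distribution//; first exact: (measurableT_comp mEf).
  exact: intf2.
under eq_integral do rewrite E.
have mg : measurable_fun setT (fun y => \int[P]_w' (f (y, Z w'))%:E)%E.
  have := measurable_fubini_F int_joint.
  by apply: eq_measurable_fun => y _; rewrite /fubini_F E.
have intg : (distribution P Y).-integrable setT (fun y => \int[P]_w' (f (y, Z w'))%:E)%E.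
  have := integrable_fubini_F int_joint.
  by apply: eq_integrable => // y _; rewrite /fubini_F E.
rewrite integral_distribution//.
apply/integrableP; split; first exact: (measurableT_comp mg).
case/integrableP : intg => _; apply: le_lt_trans.
by rewrite ge0_integral_distribution//; exact: measurableT_comp.
Qed.

End independent_pair.

(** * Transfer from fixed points to random points *)

Section fresh_sample.
Context {d d' d1 : measure_display} {Omega : measurableType d} {R : realType}.
Variables (P : probability Omega R) (K : finType) (S : K -> measurableType d').
Variable X : forall k, Omega -> S k.
Hypothesis mX : forall k, measurable_fun setT (X k).
Hypothesis indepX : mutually_independent P X.
Variables (k0 : K) (T1 : measurableType d1) (Y : Omega -> T1).
Hypothesis mY :
  measurable_fun (setT : set (g_sigma_algebraType (other_events X k0))) Y.

Let mYO : measurable_fun setT Y.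
Proof.
move=> _ B mB; apply: (measurable_other_events mX (k0 := k0)).
exact: (mY measurableT mB).
Qed.

Let Ym : {mfun Omega >-> T1} := mfun_Sub (mem_set mYO).
Let Xm : {mfun Omega >-> S k0} := mfun_Sub (mem_set (@mX k0)).

Let indep A B : measurable A -> measurable B ->
  P (Ym @^-1` A `&` Xm @^-1` B) = (P (Ym @^-1` A) * P (Xm @^-1` B))%E.
Proof.
move=> mA mB; apply: (indep_other_events mX indepX) => //.
by rewrite -[X in <<s _ >> X]setTI; exact: (mY measurableT mA).
Qed.

(** A bound on a conditional expectation without conditioning: it holds at every frozen [y], hence
    also at a random point built from the other samples. *)
Lemma fresh_sample_le (phi : T1 * S k0 -> R) (c : R) :
  measurable_fun setT phi -> (forall x, 0 <= phi x) ->
  (forall y, \int[P]_w (phi (y, X k0 w))%:E <= c%:E)%E ->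
  (\int[P]_w (phi (Y w, X k0 w))%:E <= c%:E)%E.
Proof.
move=> mphi phi0 phic.
have mEphi : measurable_fun setT (EFin \o phi) by exact/measurable_EFinP.
have := indep_tonelli indep mEphi (fun x => phi0 x) => /= ->.
apply: (@le_trans _ _ (\int[P]_w cst c%:E w)%E).
  apply: ge0_le_integral => //.
  - by move=> w1 _; apply: integral_ge0 => w' _; rewrite lee_fin.
  - have mF := @measurable_fun_fubini_tonelli_F _ _ _ _ _
      (distribution P Xm) _ mEphi (fun x => phi0 x).
    have := measurableT_comp mF mYO; apply: eq_measurable_fun => w1 _ /=.
    rewrite /fubini_F ge0_integral_distribution//; last by move=> y; rewrite lee_fin.
    exact: measurableT_comp.
by rewrite integral_cst// -[leRHS]mule1 -(probability_setT P).
Qed.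

Lemma fresh_sample_centered (phi : T1 * S k0 -> R) :
  measurable_fun setT phi ->
  P.-integrable setT (fun w => (phi (Y w, X k0 w))%:E) ->
  (forall y, P.-integrable setT (fun w => (phi (y, X k0 w))%:E)) ->
  (forall y, \int[P]_w (phi (y, X k0 w))%:E = 0)%E ->
  (\int[P]_w (phi (Y w, X k0 w))%:E = 0)%E.
Proof.
move=> mphi iphi iphi2 phi0.
have := indep_fubini indep mphi iphi iphi2 => /= ->.
by rewrite integral0_eq// => w _; exact: phi0.
Qed.

End fresh_sample.

(** * Unrolling one round *)

Section unrolling.
Variables (R : realType) (N p b : nat) (d : measure_display).
Variables (Xi : 'I_N -> measurableType d) (l : forall n, 'rV[R]_p -> Xi n -> R).
Variables (W : 'M[R]_N) (E : nat) (gamma : R) (y0 : 'rV[R]_p).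
Variable I : forall n, nat -> b.-tuple (Xi n).
Hypothesis N0 : (0 < N)%N.
Hypothesis E0 : (0 < E)%N.
Hypothesis W1 : W *m (const_mx 1 : 'cV[R]_N) = const_mx 1.
Hypothesis W2 : (const_mx 1 : 'rV[R]_N) *m W = const_mx 1.

Let state r := lsgt l W E gamma y0 I r.
Let inner r q := local_updates l W E gamma I r q (state r).

(* Y r q is the point where the gradients of batch r * E + q are evaluated; for
   q = 0 it is the iterate before mixing. *)
Definition round_y r q := if q is 0 then iter_y (state r) else iter_y (inner r q).
Definition round_g r q := iter_g (inner r q).
Definition round_v r := iter_v (state r).

Lemma round_y_inner r q : (0 < q)%N -> round_y r q = iter_y (inner r q).
Proof. by case: q. Qed.

(** At [q = 0] the stored gradient is inherited from the last local step of the preceding round,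
    whose batch index is also [r * E]; mixing does not touch it, so it belongs to the unmixed
    iterate. *)
Lemma round_gE r q : round_g r q = all_gradients l I (r * E + q) (round_y r q).
Proof.
have innerE r' q' : (0 < q')%N -> iter_g (inner r' q') =
    all_gradients l I (r' * E + q') (iter_y (inner r' q')) by case: q'.
case: q => [|q] //; rewrite addn0; case: r => [|r]; first by rewrite mul0n.
by rewrite [LHS](innerE r E E0) mulSn addnC.
Qed.

(** The corrections of the tracker telescope, which leaves only the newest gradient and the one at
    the start of the round. *)
Lemma inner_vE r q : iter_v (inner r q) = W *m round_v r + round_g r q - round_g r 0.
Proof.
rewrite /inner; elim: q => [|q IH]; first by rewrite /= addrK.
transitivity (iter_v (inner r q) + round_g r q.+1 - round_g r q); first by [].
rewrite /inner IH; set x := W *m _; set g := round_g r q.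
by rewrite [LHS]addrAC (addrAC (x + g)) addrK addrAC.
Qed.

Lemma inner_yE r q : iter_y (inner r q) =
  W *m round_y r 0 - gamma *: (q%:R *: (W *m round_v r) +
    \sum_(j < q) (round_g r j - round_g r 0)).
Proof.
elim: q => [|q IH]; first by rewrite big_ord0 scale0r addr0 scaler0 subr0.
rewrite [LHS]/= -/(inner r q) IH inner_vE big_ord_recr /= -addrA -opprD -scalerDr.
congr (_ - _ *: _); set w := W *m round_v r.
by rewrite -(addrA w) addrACA -natr1 scalerDl scale1r.
Qed.

Lemma round_yE r q : (0 < q)%N -> round_y r q =
  W *m round_y r 0 - gamma *: (q%:R *: (W *m round_v r) +
    \sum_(j < q) (round_g r j - round_g r 0)).
Proof. by case: q => // q _; rewrite -inner_yE. Qed.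

Lemma round_y_next r : round_y r.+1 0 = round_y r E.
Proof. by rewrite [RHS]round_y_inner. Qed.

Lemma round_v_next r : round_v r.+1 = W *m round_v r + round_g r E - round_g r 0.
Proof. by rewrite -inner_vE. Qed.

(** Gradient tracking: mixing preserves means and each correction replaces the old gradient by the
    new one, so the equality of the initialization persists. *)
Lemma row_mean_round_v r : row_mean (round_v r) = row_mean (round_g r 0).
Proof.
elim: r => [|r IH]; first by [].
by rewrite round_v_next row_meanB row_meanD (row_mean_mix W2) IH addrAC subrr add0r.
Qed.

Lemma row_mean_round_y r q :
  row_mean (round_y r q.+1) = row_mean (round_y r q) - gamma *: row_mean (round_g r q).
Proof.
have -> : round_y r q.+1 = iter_y (inner r q) - gamma *: iter_v (inner r q) by [].
rewrite row_meanB row_meanZ inner_vE row_meanB row_meanD (row_mean_mix W2).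
rewrite row_mean_round_v addrAC subrr add0r; congr (_ - _).
(* At [q = 0] the step starts from the mixed iterate while [round_y] is the unmixed one; their means
   agree, so the chain of means has no jump between rounds. *)
by case: q => [|q] //; rewrite inner_yE scale0r big_ord0 addr0 scaler0 subr0 row_mean_mix.
Qed.

Lemma row_mean_round_y00 : row_mean (round_y 0 0) = y0.
Proof.
apply/rowP => j; rewrite row_meanE.
under eq_bigr do rewrite mxE.
by rewrite sumr_const card_ord -[X in _ * X]mulr_natl mulKf// pnatr_eq0 -lt0n.
Qed.

Lemma consensus_error_round_y00 : consensus_error (round_y 0 0) = 0.
Proof.
rewrite /consensus_error row_mean_round_y00; apply/matrixP => i j.
by rewrite !mxE big_ord1 mxE mul1r subrr.
Qed.

End unrolling.

Arguments round_y : simpl never.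

(** * Pointwise one-step inequalities *)

Section one_step_bounds.
Variables (R : realType) (N p : nat) (W : 'M[R]_N) (lam gamma : R).
Hypothesis N0 : (0 < N)%N.
Hypothesis W1 : W *m (const_mx 1 : 'cV[R]_N) = const_mx 1.
Hypothesis W2 : (const_mx 1 : 'rV[R]_N) *m W = const_mx 1.
Hypothesis opW : forall X : 'M[R]_(N, p),
  sqn ((W - N%:R^-1 *: const_mx 1) *m X) <= lam ^+ 2 * sqn X.
Hypothesis lam1 : lam ^+ 2 < 1.
Let mu := 1 - lam ^+ 2.

Let mu0 : 0 < mu. Proof. by rewrite subr_gt0. Qed.

Lemma sqn_mix_consensus_le (V : 'M[R]_(N, p)) :
  sqn (consensus_error (W *m V)) <= sqn (consensus_error V).
Proof.
rewrite (consensus_error_mix N0 W1 W2); apply: le_trans (opW _) _.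
by rewrite ler_piMl ?sqn_ge0// ltW.
Qed.

(** Young with parameter mu/2: (1 + mu/2)(1 - mu) <= 1 - mu/2, and 1 + 2/mu <= 3/mu because mu <=
    1. *)
Lemma sqn_contraction (X Y : 'M[R]_(N, p)) :
  sqn ((W - N%:R^-1 *: const_mx 1) *m X + Y) <= (1 - mu / 2) * sqn X + 3 / mu * sqn Y.
Proof.
have mu2 : 0 < mu / 2 by rewrite divr_gt0.
apply: le_trans (sqnD_young _ _ mu2) _; apply: lerD.
  apply: le_trans (_ : (1 + mu / 2) * (lam ^+ 2 * sqn X) <= _).
    by rewrite ler_wpM2l// addr_ge0// ltW.
  rewrite mulrA ler_wpM2r ?sqn_ge0//.
  have -> : lam ^+ 2 = 1 - mu by rewrite /mu; ring.
  by have := sqr_ge0 mu; lra.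
rewrite ler_wpM2r ?sqn_ge0// invf_div.
have : 1 <= mu^-1 by rewrite invf_ge1// /mu; have := sqr_ge0 lam; lra.
lra.
Qed.

Lemma consensus_v_step (V GE G0 : 'M[R]_(N, p)) :
  sqn (consensus_error (W *m V + GE - G0)) <=
  (1 - mu / 2) * sqn (consensus_error V) + 3 / mu * sqn (GE - G0).
Proof.
rewrite -addrA consensus_errorD (consensus_error_mix N0 W1 W2).
apply: le_trans (sqn_contraction _ _) _; rewrite lerD2l ler_wpM2l//.
  by rewrite divr_ge0// ltW.
exact: sqn_consensus_error_le.
Qed.

Lemma consensus_y_step (Z0 V : 'M[R]_(N, p)) (q : nat) (D : nat -> 'M[R]_(N, p)) :
  sqn (consensus_error
    (W *m Z0 - gamma *: (q%:R *: (W *m V) + \sum_(j < q) D j))) <=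
  (1 - mu / 2) * sqn (consensus_error Z0) + 6 / mu * gamma ^+ 2 *
    (q%:R ^+ 2 * sqn (consensus_error V) + q%:R * \sum_(j < q) sqn (D j)).
Proof.
rewrite consensus_errorB (consensus_error_mix N0 W1 W2).
apply: le_trans (sqn_contraction _ _) _; rewrite lerD2l.
rewrite (_ : 6 / mu * gamma ^+ 2 = 3 / mu * (gamma ^+ 2 * 2)); last first.
  by field; rewrite gt_eqF.
rewrite -[leRHS]mulrA ler_wpM2l ?divr_ge0 ?(ltW mu0)// sqnN consensus_errorZ sqnZ.
rewrite -[leRHS]mulrA.
rewrite ler_wpM2l ?sqr_ge0// consensus_errorD consensus_errorZ.
apply: le_trans (sqnD_le _ _) _; rewrite -mulrDr ler_wpM2l// lerD//.
  by rewrite sqnZ ler_wpM2l ?sqr_ge0// sqn_mix_consensus_le.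
by apply: le_trans (sqn_consensus_error_le N0 _) _; exact: sqn_sum_le.
Qed.

Variables (f : 'I_N -> 'rV[R]_p -> R) (L : R).
Hypothesis L0 : 0 < L.
Hypothesis df : forall n y, differentiable (f n) y.
Hypothesis f_lip : forall n y y',
  sqn (gradient (f n) y - gradient (f n) y') <= L ^+ 2 * sqn (y - y').

(** The gradients at both points are compared through the exact ones, so noise enters only at the
    two endpoints. *)
Lemma gradient_change (Z Z' G G' : 'M[R]_(N, p)) :
  sqn (G - G') <= 3 * (L ^+ 2 * sqn (Z - Z') +
    sqn (G - agent_gradients f Z) + sqn (G' - agent_gradients f Z')).
Proof.
have -> : G - G' = (agent_gradients f Z - agent_gradients f Z') +
    (G - agent_gradients f Z) + (agent_gradients f Z' - G').
  by rewrite (addrC (agent_gradients f Z - _)) !addrA !subrK.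
apply: le_trans (sqnD3_le _ _ _) _; rewrite ler_wpM2l// (sqnBC _ G').
by rewrite !lerD2r agent_gradients_lip.
Qed.

(** The displacement due to mixing costs 8 = 2 (2 + 2) consensus errors, the gradient part 6 = 2 *
    3. The mean of the trackers is not small near consensus: it equals the mean of [G0], and
    produces the term in the true mean gradient that the descent inequality later absorbs. *)
Lemma drift_bound (Z0 V G0 : 'M[R]_(N, p)) (q E : nat) (D : nat -> 'M[R]_(N, p)) :
  (q <= E)%N -> row_mean V = row_mean G0 ->
  sqn (W *m Z0 - gamma *: (q%:R *: (W *m V) + \sum_(j < q) D j) - Z0) <=
  8 * sqn (consensus_error Z0) +
  6 * gamma ^+ 2 * E%:R ^+ 2 * (sqn (consensus_error V) +
    2 * N%:R * sqn (row_mean (agent_gradients f Z0)) + 2 * sqn (G0 - agent_gradients f Z0))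
  + 6 * gamma ^+ 2 * E%:R * \sum_(j < q) sqn (D j).
Proof.
move=> qE meanV; rewrite addrAC.
apply: le_trans (sqnB_le _ _) _; rewrite -addrA; apply: lerD.
  rewrite (mix_subrE N0 W1 W2).
  have := sqnB_le ((W - N%:R^-1 *: const_mx 1) *m consensus_error Z0) (consensus_error Z0).
  have := opW (consensus_error Z0).
  have : lam ^+ 2 * sqn (consensus_error Z0) <= sqn (consensus_error Z0).
    by rewrite ler_piMl ?sqn_ge0// ltW.
  lra.
rewrite sqnZ.
have -> : W *m V = consensus_error (W *m V) + (const_mx 1 : 'cV[R]_N) *m row_mean G0.
  by rewrite /consensus_error (row_mean_mix W2) meanV subrK.
set A := consensus_error (W *m V); set M := _ *m row_mean G0.
have sM : sqn M <= 2 * N%:R * sqn (row_mean (agent_gradients f Z0)) +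
    2 * sqn (G0 - agent_gradients f Z0).
  have -> : sqn M = N%:R * sqn (row_mean G0).
    rewrite sqn_row (eq_bigr (fun=> sqn (row_mean G0))).
      by rewrite sumr_const card_ord mulr_natl.
    by move=> i _; congr sqn; apply/rowP => j; rewrite !mxE big_ord1 !mxE mul1r.
  have := sqnD_le (row_mean (agent_gradients f Z0)) (row_mean G0 - row_mean (agent_gradients f Z0)).
  rewrite addrC subrK -row_meanB => H.
  have := sqn_row_mean_le N0 (G0 - agent_gradients f Z0).
  have NR : 0 <= N%:R :> R by exact: ler0n.
  by have := ler_wpM2l NR H; lra.
have sA : sqn A <= sqn (consensus_error V) by exact: sqn_mix_consensus_le.
have q2 : q%:R ^+ 2 <= E%:R ^+ 2 :> R by rewrite -!natrX ler_nat leq_exp2r.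
have qER : q%:R <= E%:R :> R by rewrite ler_nat.
set S := \sum_(j < q) sqn (D j).
have S0 : 0 <= S by apply: sumr_ge0 => j _; exact: sqn_ge0.
have E2 : 0 <= E%:R ^+ 2 :> R by exact: sqr_ge0.
have : sqn (q%:R *: (A + M) + \sum_(j < q) D j) <=
    3 * (E%:R ^+ 2 * (sqn A + sqn M) + E%:R * S).
  rewrite scalerDr; apply: le_trans (sqnD3_le _ _ _) _; rewrite ler_wpM2l// !sqnZ mulrDr.
  apply: lerD; last first.
    by apply: le_trans (sqn_sum_le _) _; rewrite ler_wpM2r.
  by apply: lerD; rewrite ler_wpM2r ?sqn_ge0.
have g2 := sqr_ge0 gamma.
move=> /(ler_wpM2l g2) H.
have : gamma ^+ 2 * (E%:R ^+ 2 * (sqn A + sqn M)) <= gamma ^+ 2 * (E%:R ^+ 2 *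
  (sqn (consensus_error V) + (2 * N%:R * sqn (row_mean (agent_gradients f Z0)) +
    2 * sqn (G0 - agent_gradients f Z0)))).
  by rewrite ler_wpM2l// ler_wpM2l// lerD.
lra.
Qed.

Let F y := N%:R^-1 * \sum_(n < N) f n y.

(** [mdot_ge] yields 3/4 |a|^2 and the quadratic term costs 1/8 since 2 L gamma <= 1/8. Passing from
    the mean gradient at [Z] to the one at the start [Z0] of the round halves the remaining 5/8 to
    5/16. The factor 21/8 is 5/8 from that passage plus 2 from the consensus error of [Z]. *)
Lemma descent_step (Z0 Z G : 'M[R]_(N, p)) : 0 <= gamma -> 2 * L * gamma <= 8^-1 ->
  F (row_mean Z - gamma *: row_mean G) <= F (row_mean Z)
    - 5 / 16 * gamma * sqn (row_mean (agent_gradients f Z0))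
    + gamma * (L ^+ 2 / N%:R) * (21 / 8 * sqn (Z - Z0) + 2 * sqn (consensus_error Z0))
    - gamma * mdot (gradient F (row_mean Z)) (row_mean (G - agent_gradients f Z))
    + 2 * L * gamma ^+ 2 * sqn (row_mean (G - agent_gradients f Z)).
Proof.
move=> g0 Lg.
have NR : 0 < N%:R :> R by rewrite ltr0n.
set a := row_mean (agent_gradients f Z); set a0 := row_mean (agent_gradients f Z0).
set n := row_mean (G - _); set dF := gradient F _.
have -> : row_mean G = a + n by rewrite /n row_meanB addrC subrK.
have H1 : F (row_mean Z - gamma *: (a + n)) <= F (row_mean Z) -
    gamma * (mdot dF a + mdot dF n) + L * (gamma ^+ 2 * sqn (a + n)).
  apply: le_trans (descent_average N0 L0 df f_lip _ _) _.
  by rewrite sqnN sqnZ -{1}scaleNr mdotZr mdotDr mulNr.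
have H2 := mdot_ge dF a.
have H3 : sqn (dF - a) <= L ^+ 2 / N%:R * sqn (consensus_error Z).
  by rewrite mulrAC ler_pdivlMr// mulrC; exact: gradient_gap.
have H4 := sqnD_le a n.
have H5 : sqn a0 <= 2 * sqn a + 2 * (L ^+ 2 / N%:R * sqn (Z - Z0)).
  rewrite -{1}(subrK a a0) addrC; apply: le_trans (sqnD_le _ _) _.
  rewrite lerD2l ler_wpM2l//.
  rewrite mulrAC ler_pdivlMr// mulrC /a0 /a -row_meanB.
  apply: le_trans (sqn_row_mean_le N0 _) _.
  by apply: le_trans (agent_gradients_lip f_lip _ _) _; rewrite sqnBC.
have H6 : sqn (consensus_error Z) <= 2 * sqn (consensus_error Z0) + 2 * sqn (Z - Z0).
  rewrite -{1}(subrK Z0 Z) addrC consensus_errorD; apply: le_trans (sqnD_le _ _) _.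
  by rewrite lerD2l ler_wpM2l// sqn_consensus_error_le.
set c := L ^+ 2 / N%:R in H3 H5 *.
have c0 : 0 <= c by rewrite divr_ge0 ?sqr_ge0// ltW.
have K2 := ler_wpM2l g0 H2.
have K3 := ler_wpM2l g0 H3.
have K5 := ler_wpM2l g0 H5.
have K6 := ler_wpM2l (mulr_ge0 g0 c0) H6.
have K4 : L * (gamma ^+ 2 * sqn (a + n)) <= L * gamma ^+ 2 * (2 * sqn a + 2 * sqn n).
  by rewrite mulrA ler_wpM2l// mulr_ge0 ?sqr_ge0// ltW.
have K7 : 2 * L * gamma * (gamma * sqn a) <= 8^-1 * (gamma * sqn a).
  by rewrite ler_wpM2r// mulr_ge0// sqn_ge0.
have sa := mulr_ge0 g0 (sqn_ge0 a).
lra.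
Qed.

End one_step_bounds.

(** * Measurability of the iterates *)

Section measurable_matrices.
Context {R : realType} {d : measure_display} {T : measurableType d}.

Lemma measurable_mx_cst m n (A : 'M[R]_(m, n)) : measurable_mx (fun _ : T => A).
Proof. by move=> i j; exact: measurable_cst. Qed.

Lemma measurable_mxD m n (A B : T -> 'M[R]_(m, n)) :
  measurable_mx A -> measurable_mx B -> measurable_mx (fun t => A t + B t).
Proof.
by move=> mA mB i j; under eq_fun do rewrite mxE; exact: measurable_funD.
Qed.

Lemma measurable_mxZ m n (c : R) (A : T -> 'M[R]_(m, n)) :
  measurable_mx A -> measurable_mx (fun t => c *: A t).
Proof.
by move=> mA i j; under eq_fun do rewrite mxE; exact: measurable_funM.
Qed.

Lemma measurable_mxB m n (A B : T -> 'M[R]_(m, n)) :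
  measurable_mx A -> measurable_mx B -> measurable_mx (fun t => A t - B t).
Proof.
move=> mA mB; apply: measurable_mxD => //.
by under eq_fun do rewrite -scaleN1r; exact: measurable_mxZ.
Qed.

Lemma measurable_mx_mull m n k (M : 'M[R]_(k, m)) (A : T -> 'M[R]_(m, n)) :
  measurable_mx A -> measurable_mx (fun t => M *m A t).
Proof.
move=> mA i j; under eq_fun do rewrite mxE.
by apply: measurable_sum => h; exact: measurable_funM.
Qed.

Lemma measurable_mx_sum m n (J : Type) (s : seq J) (A : J -> T -> 'M[R]_(m, n)) :
  (forall j, measurable_mx (A j)) -> measurable_mx (fun t => \sum_(j <- s) A j t).
Proof.
move=> mA i j; under eq_fun do rewrite summxE.
by apply: measurable_sum => h; exact: mA.
Qed.

Lemma measurable_mx_row m n i (A : T -> 'M[R]_(m, n)) :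
  measurable_mx A -> measurable_mx (fun t => row i (A t)).
Proof. by move=> mA i' j; under eq_fun do rewrite mxE; exact: mA. Qed.

Lemma measurable_mx_row_mean m n (A : T -> 'M[R]_(m, n)) :
  measurable_mx A -> measurable_mx (fun t => row_mean (A t)).
Proof.
by move=> mA; apply: measurable_mxZ; apply: measurable_mx_sum => i;
  exact: measurable_mx_row.
Qed.

Lemma measurable_mx_consensus m n (A : T -> 'M[R]_(m, n)) :
  measurable_mx A -> measurable_mx (fun t => consensus_error (A t)).
Proof.
move=> mA; apply: measurable_mxB => //; apply: measurable_mx_mull.
exact: measurable_mx_row_mean.
Qed.

Lemma measurable_mx_of_rows m n (A : 'I_m -> T -> 'rV[R]_n) :
  (forall i, measurable_mx (A i)) -> measurable_mx (fun t => \matrix_(i < m) A i t).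
Proof. by move=> mA i j; under eq_fun do rewrite mxE; exact: mA. Qed.

Lemma measurable_sqn m n (A : T -> 'M[R]_(m, n)) :
  measurable_mx A -> measurable_fun setT (fun t => sqn (A t)).
Proof.
move=> mA; apply: measurable_sum => i; apply: measurable_sum => j.
by apply: measurable_funX; exact: mA.
Qed.

Lemma measurable_mdot m n (A B : T -> 'M[R]_(m, n)) :
  measurable_mx A -> measurable_mx B -> measurable_fun setT (fun t => mdot (A t) (B t)).
Proof.
move=> mA mB; apply: measurable_sum => i; apply: measurable_sum => j.
by apply: measurable_funM; [exact: mA|exact: mB].
Qed.

End measurable_matrices.

Section measurable_gradients.
Context {R : realType} {d : measure_display} {T : measurableType d}.
Variables (N p : nat).

Lemma continuous_lipschitz_gradient (f : 'rV[R]_p -> R) (L : R) : 0 < L ->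
  (forall y y', sqn (gradient f y - gradient f y') <= L ^+ 2 * sqn (y - y')) ->
  forall j, continuous (fun y => gradient f y 0 j).
Proof.
move=> L0 flip j y; apply/(@cvgrPdist_le _ _ _ (nbhs y) (nbhs_filter y)) => e e0.
have c : continuous (fun z : 'rV[R]_p => sqn (y - z)).
  apply: continuous_sqn => a k z; under eq_fun do rewrite !mxE.
  by apply: continuousB; [exact: cst_continuous|exact: coord_continuous].
have eL : 0 < (e / L) ^+ 2 by rewrite exprn_gt0// divr_gt0.
have /(@cvgrPdist_le _ _ _ (nbhs y) (nbhs_filter y))/(_ _ eL) := @c y.
apply: filterS => z /=; rewrite subrr sqn0 sub0r normrN ger0_norm ?sqn_ge0// => H.
rewrite -(ler_pXn2r (n := 2))// ?nnegrE ?(ltW e0)// real_normK ?num_real//.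
apply: (@le_trans _ _ (sqn (gradient f y - gradient f z))).
  rewrite /sqn big_ord1 (bigD1 j)//= !mxE lerDl.
  by apply: sumr_ge0 => k _; exact: sqr_ge0.
apply: le_trans (flip _ _) _.
apply: le_trans (ler_wpM2l (sqr_ge0 L) H) _.
by rewrite -exprMn mulrC divfK// gt_eqF.
Qed.

(** [measurable_caratheodory] with a dummy sample: the gradient is continuous in the point and
    constant in the second argument. *)
Lemma measurable_lipschitz_gradient (f : 'rV[R]_p -> R) (L : R) (Y : T -> 'rV[R]_p) :
  0 < L ->
  (forall y y', sqn (gradient f y - gradient f y') <= L ^+ 2 * sqn (y - y')) ->
  measurable_mx Y -> measurable_mx (fun t => gradient f (Y t)).
Proof.
move=> L0 flip mY i j; rewrite ord1.
apply: (measurable_caratheodory (h := fun y (_ : T) => gradient f y 0 j) (Z := id)) => //.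
by move=> _; exact: continuous_lipschitz_gradient flip j.
Qed.

Lemma measurable_agent_gradients (f : 'I_N -> 'rV[R]_p -> R) (L : R)
    (Z : T -> 'M[R]_(N, p)) : 0 < L ->
  (forall n y y', sqn (gradient (f n) y - gradient (f n) y') <= L ^+ 2 * sqn (y - y')) ->
  measurable_mx Z -> measurable_mx (fun t => agent_gradients f (Z t)).
Proof.
move=> L0 flip mZ; apply: measurable_mx_of_rows => n.
by apply: measurable_lipschitz_gradient (flip n) _ => //; exact: measurable_mx_row.
Qed.

End measurable_gradients.

Section measurable_iterates.
Variables (R : realType) (N p b : nat) (dX : measure_display).
Variables (Xi : 'I_N -> measurableType dX) (l : forall n, 'rV[R]_p -> Xi n -> R).
Hypothesis ml : forall n y, measurable_fun setT (l y : Xi n -> R).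
Hypothesis dl : forall n (x : Xi n) y, differentiable (fun z => l z x) y.
Variables (W : 'M[R]_N) (E : nat) (gamma : R) (y0 : 'rV[R]_p).
Hypothesis E0 : (0 < E)%N.
Context {d : measure_display} {T : measurableType d}.
Variable I : forall n, nat -> T -> b.-tuple (Xi n).

Lemma measurable_minibatch_gradient n (Y : T -> 'rV[R]_p) (Z : T -> b.-tuple (Xi n)) :
  measurable_mx Y -> measurable_fun setT Z ->
  measurable_mx (fun t => minibatch_gradient l (Y t) (Z t)).
Proof.
move=> mY mZ; apply: measurable_mxZ; apply: measurable_mx_sum => i.
apply: (measurable_gradient_param (h := @l n) (Z := fun t => tnth (Z t) i)) => //.
by move/measurable_fun_tnthP : mZ; exact.
Qed.

Let batches t := fun n k => I n k t.

Let measurable_state (s : T -> lsgt_state R N p) :=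
  [/\ measurable_mx (fun t => iter_y (s t)), measurable_mx (fun t => iter_v (s t)) &
      measurable_mx (fun t => iter_g (s t))].

Let measurable_all_gradients k (Y : T -> 'M[R]_(N, p)) :
  (forall n, measurable_fun setT (I n k)) -> measurable_mx Y ->
  measurable_mx (fun t => all_gradients l (batches t) k (Y t)).
Proof.
move=> mI mY; apply: measurable_mx_of_rows => n.
by apply: measurable_minibatch_gradient => //; exact: measurable_mx_row.
Qed.

Let measurable_inner (s : T -> lsgt_state R N p) r q :
  (forall n k, (k <= r * E + q)%N -> measurable_fun setT (I n k)) ->
  measurable_state s ->
  measurable_state (fun t => local_updates l W E gamma (batches t) r q (s t)).
Proof.
move=> + [my mv mg]; elim: q => [|q IH] mI.
  by split => //; exact: measurable_mx_mull.
have [|y v g] := IH; first by move=> n k H; apply: mI; rewrite addnS ltnW.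
have Y : measurable_mx (fun t => iter_y (local_updates l W E gamma (batches t) r q (s t))
    - gamma *: iter_v (local_updates l W E gamma (batches t) r q (s t))).
  by apply: measurable_mxB => //; exact: measurable_mxZ.
have G := measurable_all_gradients (fun n => mI n _ (leqnn _)) Y.
by split => //; apply: measurable_mxB => //; exact: measurable_mxD.
Qed.

Let measurable_lsgt r :
  (forall n k, (k <= r * E)%N -> measurable_fun setT (I n k)) ->
  measurable_state (fun t => lsgt l W E gamma y0 (batches t) r).
Proof.
elim: r => [|r IH] mI.
  have mY0 : measurable_mx (fun t : T => \matrix_(n < N) y0).
    exact: measurable_mx_cst.
  have G0 : measurable_mx (fun t : T => all_gradients l (batches t) 0 (\matrix_(n < N) y0)).
    by apply: measurable_all_gradients => // n; exact: mI.
  by split.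
apply: measurable_inner; first by move=> n k; rewrite addnC -mulSn; exact: mI.
by apply: IH => n k H; apply: mI; rewrite mulSn (leq_trans H)// leq_addl.
Qed.

(** The strict bound on batch indices expresses that an iterate depends only on earlier batches. The
    space [T] is arbitrary, so the lemma also applies to [Omega] with the sigma-algebra generated by
    all batches but one. *)
Lemma measurable_round_y r q :
  (forall n k, (k < r * E + q)%N -> measurable_fun setT (I n k)) ->
  measurable_mx (fun t => round_y l W E gamma y0 (batches t) r q).
Proof.
have main r' q' : (forall n k, (k <= r' * E + q')%N -> measurable_fun setT (I n k)) ->
    measurable_mx (fun t => round_y l W E gamma y0 (batches t) r' q'.+1).
  move=> mI; have [] : measurable_state (fun t => local_updates l W E gamma (batches t) r' q'
      (lsgt l W E gamma y0 (batches t) r')).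
    apply: measurable_inner => //; apply: measurable_lsgt => n k H.
    by apply: mI; rewrite (leq_trans H)// leq_addr.
  by move=> y v _; apply: measurable_mxB => //; exact: measurable_mxZ.
case: q => [|q] mI; last by apply: main => n k H; apply: mI; rewrite addnS ltnS.
case: r mI => [|r] mI; first exact: measurable_mx_cst.
(* The unmixed iterate of a round is the last local iterate of the preceding one, that is [q'.+1]
   with [q' = E.-1]. *)
under eq_fun do rewrite round_y_next//.
have := main r E.-1; rewrite prednK//; apply => n k H; apply: mI.
by rewrite addn0 mulSn addnC; case: (E) E0 H => // E' _; rewrite addnS ltnS.
Qed.

End measurable_iterates.

(** * Square-integrable random matrices *)

Section square_integrable.
Context {d : measure_display} {Omega : measurableType d} {R : realType}.
Variable P : probability Omega R.

Definition integrable_rv (X : Omega -> R) := P.-integrable setT (EFin \o X).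

Definition sq_integrable m n (A : Omega -> 'M[R]_(m, n)) :=
  measurable_mx A /\ integrable_rv (fun w => sqn (A w)).

Lemma integrable_rv_le (X Y : Omega -> R) : measurable_fun setT X ->
  (forall w, `|X w| <= Y w) -> integrable_rv Y -> integrable_rv X.
Proof.
move=> mX XY; apply: le_integrable => //; first exact/measurable_EFinP.
by move=> w _ /=; rewrite lee_fin (le_trans (XY w))// ler_norm.
Qed.

Lemma integrable_rvD (X Y : Omega -> R) :
  integrable_rv X -> integrable_rv Y -> integrable_rv (fun w => X w + Y w).
Proof. by move=> iX iY; exact: (integrableD measurableT iX iY). Qed.

Lemma integrable_rvZ (c : R) (X : Omega -> R) :
  integrable_rv X -> integrable_rv (fun w => c * X w).
Proof. by move=> iX; exact: (integrableZl measurableT c iX). Qed.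

Lemma integrable_rv_cst (c : R) : integrable_rv (fun=> c).
Proof. exact: finite_measure_integrable_cst. Qed.

Lemma integrable_rv_sum (J : Type) (s : seq J) (X : J -> Omega -> R) :
  (forall j, integrable_rv (X j)) -> integrable_rv (fun w => \sum_(j <- s) X j w).
Proof.
move=> iX; elim: s => [|j s IH].
  by under eq_fun do rewrite big_nil; exact: integrable_rv_cst.
by under eq_fun do rewrite big_cons; exact: integrable_rvD.
Qed.

Lemma sq_integrable_le m n m' n' (A : Omega -> 'M[R]_(m, n)) (B : Omega -> 'M[R]_(m', n'))
    (c c' : R) : measurable_mx A ->
  (forall w, sqn (A w) <= c * sqn (B w) + c') -> sq_integrable B -> sq_integrable A.
Proof.
move=> mA AB [mB iB]; split => //.
apply: (@integrable_rv_le _ (fun w => c * sqn (B w) + c')).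
- exact: measurable_sqn.
- by move=> w; rewrite ger0_norm ?sqn_ge0.
- by apply: integrable_rvD (integrable_rv_cst _); exact: integrable_rvZ.
Qed.

Lemma sq_integrableD m n (A B : Omega -> 'M[R]_(m, n)) :
  sq_integrable A -> sq_integrable B -> sq_integrable (fun w => A w + B w).
Proof.
move=> [mA iA] [mB iB]; split; first exact: measurable_mxD.
apply: (@integrable_rv_le _ (fun w => 2 * sqn (A w) + 2 * sqn (B w))).
- by apply: measurable_sqn; exact: measurable_mxD.
- by move=> w; rewrite ger0_norm ?sqn_ge0// sqnD_le.
- by apply: integrable_rvD; exact: integrable_rvZ.
Qed.

Lemma sq_integrableZ m n (c : R) (A : Omega -> 'M[R]_(m, n)) :
  sq_integrable A -> sq_integrable (fun w => c *: A w).
Proof.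
move=> sA; apply: (@sq_integrable_le _ _ _ _ _ A (c ^+ 2) 0) => //.
  by apply: measurable_mxZ; case: sA.
by move=> w; rewrite sqnZ addr0.
Qed.

Lemma sq_integrableB m n (A B : Omega -> 'M[R]_(m, n)) :
  sq_integrable A -> sq_integrable B -> sq_integrable (fun w => A w - B w).
Proof.
move=> sA sB; apply: sq_integrableD => //.
by under eq_fun do rewrite -scaleN1r; exact: sq_integrableZ.
Qed.

Lemma sq_integrable_cst m n (A : 'M[R]_(m, n)) : sq_integrable (fun=> A).
Proof. by split; [exact: measurable_mx_cst|exact: integrable_rv_cst]. Qed.

Lemma sq_integrable_sum m n (J : Type) (s : seq J) (A : J -> Omega -> 'M[R]_(m, n)) :
  (forall j, sq_integrable (A j)) -> sq_integrable (fun w => \sum_(j <- s) A j w).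
Proof.
move=> sA; elim: s => [|j s IH].
  by under eq_fun do rewrite big_nil; exact: sq_integrable_cst.
by under eq_fun do rewrite big_cons; exact: sq_integrableD.
Qed.

Lemma sq_integrable_of_rows m n (A : Omega -> 'M[R]_(m, n)) :
  (forall i, sq_integrable (fun w => row i (A w))) -> sq_integrable A.
Proof.
move=> sA; split.
  move=> i j; have [mA _] := sA i; have := mA 0 j.
  by under eq_fun do rewrite mxE.
rewrite /integrable_rv; under eq_fun do rewrite sqn_row.
by apply: integrable_rv_sum => i; case: (sA i).
Qed.

Lemma integrable_mdot m n (A B : Omega -> 'M[R]_(m, n)) :
  sq_integrable A -> sq_integrable B -> integrable_rv (fun w => mdot (A w) (B w)).
Proof.
move=> [mA iA] [mB iB].
apply: (@integrable_rv_le _ (fun w => 1 * sqn (A w) + 1 * sqn (B w))).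
- exact: measurable_mdot.
- move=> w; have := sqn_ge0 (A w + B w); have := sqn_ge0 (A w - B w).
  rewrite !sqnDE sqnN -(scaleN1r (B w)) mdotZr => H1 H2.
  have := sqn_ge0 (A w); have := sqn_ge0 (B w) => H3 H4.
  by rewrite ler_norml; apply/andP; split; lra.
- by apply: integrable_rvD; exact: integrable_rvZ.
Qed.

(** Integrates a pointwise linear inequality. The list pairs coefficients, possibly negative, with
    integrable variables, so that each one-step bound passes to expectations in a single
    application. *)
Lemma le_Rintegral_comb (X : Omega -> R) (s : seq (R * (Omega -> R))) :
  integrable_rv X ->
  foldr (fun cY Q => integrable_rv cY.2 /\ Q) True s ->
  (forall w, X w <= \sum_(cY <- s) cY.1 * cY.2 w) ->
  \int[P]_w X w <= \sum_(cY <- s) cY.1 * \int[P]_w cY.2 w.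
Proof.
move=> iX is_ leX.
have [iS <-] : integrable_rv (fun w => \sum_(cY <- s) cY.1 * cY.2 w) /\
    \int[P]_w (\sum_(cY <- s) cY.1 * cY.2 w) = \sum_(cY <- s) cY.1 * \int[P]_w cY.2 w.
  elim: s is_ {leX} => [_|[c Y] s IH [iY /IH[iS eS]]].
    rewrite big_nil; split; first by under eq_fun do rewrite big_nil; exact: integrable_rv_cst.
    under eq_Rintegral do rewrite big_nil.
    by rewrite Rintegral_cst// mul0r.
  split; first by under eq_fun do rewrite big_cons; apply: integrable_rvD => //; exact: integrable_rvZ.
  under eq_Rintegral do rewrite big_cons.
  rewrite RintegralD//; last exact: integrable_rvZ.
  by rewrite big_cons eS RintegralZl.
exact: le_Rintegral.
Qed.

Lemma Rintegral_sum (J : Type) (s : seq J) (X : J -> Omega -> R) :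
  (forall j, integrable_rv (X j)) ->
  \int[P]_w (\sum_(j <- s) X j w) = \sum_(j <- s) \int[P]_w X j w.
Proof.
move=> iX; elim: s => [|j s IH].
  by under eq_Rintegral do rewrite big_nil; rewrite big_nil Rintegral_cst// mul0r.
under eq_Rintegral do rewrite big_cons.
by rewrite RintegralD//; [rewrite big_cons IH|exact: iX|exact: integrable_rv_sum].
Qed.

End square_integrable.

(** * Mini-batch noise *)

Section row_of_tuple.
Context {R : realType} {d : measure_display} {T : measurableType d}.
Variable p : nat.

Definition row_of_tuple (t : p.-tuple R) : 'rV[R]_p := \row_j tnth t j.

Definition tuple_of_row (y : 'rV[R]_p) : p.-tuple R := [tuple y 0 j | j < p].

Lemma tuple_of_rowK : cancel tuple_of_row row_of_tuple.
Proof. by move=> y; apply/rowP => j; rewrite mxE tnth_mktuple. Qed.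

Lemma measurable_tuple_of_row (Y : T -> 'rV[R]_p) :
  measurable_mx Y -> measurable_fun setT (fun t => tuple_of_row (Y t)).
Proof.
move=> mY; apply/measurable_fun_tnthP => j.
by rewrite /comp; under eq_fun do rewrite tnth_mktuple; exact: mY.
Qed.

Lemma measurable_row_of_tuple (Y : T -> p.-tuple R) :
  measurable_fun setT Y -> measurable_mx (fun t => row_of_tuple (Y t)).
Proof.
by move=> /measurable_fun_tnthP mY i j; under eq_fun do rewrite mxE; exact: mY.
Qed.

End row_of_tuple.

Section minibatch_noise.
Variables (R : realType) (N p b M : nat) (dX : measure_display).
Variables (Xi : 'I_N -> measurableType dX) (l : forall n, 'rV[R]_p -> Xi n -> R).
Variables (f : 'I_N -> 'rV[R]_p -> R) (L v : R).
Context {dO : measure_display} {Omega : measurableType dO}.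
Variables (P : probability Omega R) (I : forall n, nat -> Omega -> b.-tuple (Xi n)).
Hypothesis ml : forall n y, measurable_fun setT (l y : Xi n -> R).
Hypothesis dl : forall n (x : Xi n) y, differentiable (fun z => l z x) y.
Hypothesis L0 : 0 < L.
Hypothesis f_lip : forall n y y',
  sqn (gradient (f n) y - gradient (f n) y') <= L ^+ 2 * sqn (y - y').
Hypothesis mI : forall n k, (k <= M)%N -> measurable_fun setT (I n k).
Hypothesis indepI : @mutually_independent _ _ Omega R P ('I_N * 'I_M.+1)%type
  (fun nk => b.-tuple (Xi nk.1)) (fun nk => I nk.1 nk.2).
Hypothesis unbiased : forall n k y i, (k <= M)%N ->
  'E_P[fun w => (minibatch_gradient l y (I n k w) 0%R i : R)]%E
  = (gradient (f n) y 0 i)%:E.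
Hypothesis var_le : forall n k y, (k <= M)%N ->
  ('E_P[fun w => (fnorm (minibatch_gradient l y (I n k w) - gradient (f n) y) ^+ 2)%R]
   <= v%:E)%E.

Variables (n : 'I_N) (k : nat).
Hypothesis kM : (k <= M)%N.

Let sample (nk : 'I_N * 'I_M.+1) := I nk.1 nk.2.
Let here : 'I_N * 'I_M.+1 := (n, Ordinal (kM : (k < M.+1)%N)).

(** [Omega] with the coarser sigma-algebra of all batches except that of agent [n] at index [k]. As
    a [measurableType] on the same carrier it makes the general measurability lemmas express
    dependence on the other batches only. *)
Definition others : measurableType _ := g_sigma_algebraType (other_events sample here).

Let msample nk : measurable_fun setT (sample nk).
Proof. by apply: mI; rewrite -ltnS. Qed.

Lemma measurable_others n' k' : (k' <= M)%N -> (n' != n) || (k' != k) ->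
  measurable_fun (setT : set others) (I n' k').
Proof.
move=> k'M H.
apply: (@measurable_fun_other _ _ _ _ _ sample here (n', Ordinal (k'M : (k' < M.+1)%N))).
by rewrite xpair_eqE -val_eqE /= negb_and.
Qed.

Lemma measurable_mx_others m m' (A : Omega -> 'M[R]_(m, m')) :
  measurable_mx (A : others -> 'M[R]_(m, m')) -> measurable_mx A.
Proof.
move=> mA i j _ B mB; apply: (measurable_other_events (k0 := here) msample).
exact: (mA i j measurableT).
Qed.

Definition sample_noise (Y : Omega -> 'rV[R]_p) w :=
  minibatch_gradient l (Y w) (I n k w) - gradient (f n) (Y w).

Lemma measurable_sample_noise Y : measurable_mx Y -> measurable_mx (sample_noise Y).
Proof.
move=> mY; apply: measurable_mxB; last exact: measurable_lipschitz_gradient (f_lip n) _.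
by apply: measurable_minibatch_gradient => //; exact: mI.
Qed.

Let err (t : p.-tuple R) (z : b.-tuple (Xi n)) : 'rV[R]_p :=
  minibatch_gradient l (row_of_tuple t) z - gradient (f n) (row_of_tuple t).

Let measurable_err d (T : measurableType d) (Y : T -> p.-tuple R)
    (Z : T -> b.-tuple (Xi n)) :
  measurable_fun setT Y -> measurable_fun setT Z ->
  measurable_mx (fun t => err (Y t) (Z t)).
Proof.
move=> mY mZ; have mr := measurable_row_of_tuple mY.
apply: measurable_mxB; last exact: measurable_lipschitz_gradient (f_lip n) _.
exact: measurable_minibatch_gradient.
Qed.

Let var_err t : (\int[P]_w (sqn (err t (I n k w)))%:E <= v%:E)%E.
Proof.
have := var_le n (row_of_tuple t) kM; rewrite unlock.
by under eq_integral do rewrite fnorm_sqr.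
Qed.

Let sq_integrable_of_var (A : Omega -> 'rV[R]_p) : measurable_mx A ->
  (\int[P]_w (sqn (A w))%:E <= v%:E)%E -> sq_integrable P A.
Proof.
move=> mA Av; split => //; apply/integrableP; split.
  by apply/measurable_EFinP; exact: measurable_sqn.
apply: le_lt_trans (ltry v); apply: le_trans Av.
by under eq_integral do rewrite /= ger0_norm ?sqn_ge0//.
Qed.

Let sq_integrable_err t : sq_integrable P (fun w => err t (I n k w)).
Proof.
apply: sq_integrable_of_var => //.
by apply: measurable_err; [exact: measurable_cst|exact: mI].
Qed.

Lemma sample_noise_var (Y : Omega -> 'rV[R]_p) :
  measurable_mx (Y : others -> 'rV[R]_p) ->
  sq_integrable P (sample_noise Y) /\ \int[P]_w sqn (sample_noise Y w) <= v.
Proof.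
move=> mY.
have H : (\int[P]_w (sqn (sample_noise Y w))%:E <= v%:E)%E.
  have := @fresh_sample_le _ _ _ _ _ P _ _ sample msample indepI here _
    (fun w => tuple_of_row (Y w)) (measurable_tuple_of_row mY)
    (fun tz => sqn (err tz.1 tz.2)) v.
  rewrite /= /err; under eq_integral do rewrite tuple_of_rowK.
  apply.
  - by apply: measurable_sqn; apply: (@measurable_err _ _ fst snd).
  - by move=> tz; exact: sqn_ge0.
  - by move=> t; exact: var_err.
have sN : sq_integrable P (sample_noise Y).
  apply: sq_integrable_of_var => //; apply: measurable_sample_noise.
  exact: measurable_mx_others.
split => //; rewrite -lee_fin /Rintegral fineK//.
by apply: integrable_fin_num => //; case: sN.
Qed.

(** Once [Y] and [H] are frozen, the inner product is linear in noise of mean zero. It is used with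
    [H] the gradient of the objective at the mean, and with [H] the noise of another agent. *)
Lemma sample_noise_orthogonal (Y H : Omega -> 'rV[R]_p) :
  measurable_mx (Y : others -> 'rV[R]_p) -> measurable_mx (H : others -> 'rV[R]_p) ->
  sq_integrable P H -> \int[P]_w mdot (H w) (sample_noise Y w) = 0.
Proof.
move=> mY mH sH.
have [sN _] := sample_noise_var mY.
rewrite /Rintegral.
have E w : mdot (H w) (sample_noise Y w) =
    mdot (row_of_tuple (tuple_of_row (H w))) (err (tuple_of_row (Y w)) (I n k w)).
  by rewrite /err !tuple_of_rowK.
under eq_integral do rewrite E.
rewrite (@fresh_sample_centered _ _ _ _ _ P _ _ sample msample indepI here _
  (fun w => (tuple_of_row (H w), tuple_of_row (Y w)))
  (measurable_fun_pair (measurable_tuple_of_row mH) (measurable_tuple_of_row mY))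
  (fun xz => mdot (row_of_tuple xz.1.1) (err xz.1.2 xz.2)))//=.
- apply: measurable_mdot.
    by apply: measurable_row_of_tuple; apply: measurableT_comp.
  by apply: (@measurable_err _ _ (fun xz => xz.1.2) snd) => //; exact: measurableT_comp.
- by under eq_fun do rewrite -E; exact: integrable_mdot.
- by move=> [h t] /=; apply: integrable_mdot => //; exact: sq_integrable_cst.
move=> [h t] /=.
transitivity (\int[P]_w (mdot (row_of_tuple h) (err t (I n k w))))%:E.
  rewrite /Rintegral fineK//; apply: integrable_fin_num => //.
  by apply: integrable_mdot => //; exact: sq_integrable_cst.
congr EFin.
have ierr j : integrable_rv P (fun w => err t (I n k w) 0 j).
  have := integrable_mdot (sq_integrable_cst P (delta_mx 0 j)) (sq_integrable_err t).
  rewrite /integrable_rv; apply: eq_integrable => // w _ /=; congr EFin.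
  rewrite /mdot big_ord1 (bigD1 j)//= mxE !eqxx mul1r big1 ?addr0// => i ij.
  by rewrite mxE eqxx (negbTE ij) mul0r.
transitivity (\sum_j row_of_tuple h 0 j * \int[P]_w err t (I n k w) 0 j).
  rewrite /mdot; under eq_Rintegral do rewrite big_ord1.
  rewrite Rintegral_sum; last by move=> j; exact: integrable_rvZ.
  by apply: eq_bigr => j _; rewrite RintegralZl//; exact: ierr.
rewrite big1// => j _; rewrite (_ : \int[P]_w _ = 0) ?mulr0//.
set g := gradient (f n) (row_of_tuple t).
have imb : integrable_rv P (fun w => minibatch_gradient l (row_of_tuple t) (I n k w) 0 j).
  have := integrable_rvD (ierr j) (integrable_rv_cst P (g 0 j)).
  rewrite /integrable_rv; apply: eq_integrable => // w _ /=; congr EFin.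
  by rewrite !mxE subrK.
transitivity (\int[P]_w (minibatch_gradient l (row_of_tuple t) (I n k w) 0 j - g 0 j)).
  by apply: eq_Rintegral => w _; rewrite !mxE.
rewrite RintegralB//; last exact: integrable_rv_cst.
rewrite Rintegral_cst// {1}/Rintegral.
have := unbiased n (row_of_tuple t) j kM; rewrite unlock => -> /=.
by rewrite -/g (_ : P setT = 1%E) ?mulr1 ?subrr//; exact: probability_setT.
Qed.

End minibatch_noise.

(** * Closing the feedback loop *)

Section recursion.
Variable R : realType.

(** The recursion telescopes; the induction keeps [c t] on the left, and it is dropped at the end by
    nonnegativity. *)
Lemma sum_contraction (c b : nat -> R) (rho : R) (T : nat) :
  (forall r, 0 <= c r) ->
  (forall r, (r < T)%N -> c r.+1 <= (1 - rho) * c r + b r) ->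
  rho * \sum_(r < T) c r <= c 0%N + \sum_(r < T) b r.
Proof.
move=> c0 crec.
suff H t : (t <= T)%N ->
    c t + rho * \sum_(r < t) c r <= c 0%N + \sum_(r < t) b r.
  by have := H T (leqnn T); have := c0 T; lra.
elim: t => [|t IH] tT; first by rewrite !big_ord0; lra.
rewrite !big_ord_recr /=.
have := IH (ltnW tT); have := crec t tT; lra.
Qed.

(** The variables are normalized sums over the rounds: [X] and [Bt] are L^2/N times those of the
    model consensus errors and of the drift bounds, [Dt] is (gamma E L)^2/N times that of the
    tracker errors, and k mu^4 = (gamma E L)^2. Since mu <= 1 the powers of mu drop out, leaving
    linear inequalities in k. *)
Lemma closed_loop_bound (k mu X Bt Dt A S Phi : R) :
  0 < mu -> mu <= 1 -> 0 <= k -> k <= (3 / 640) ^+ 2 ->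
  0 <= Bt -> 0 <= A -> 0 <= S -> 0 <= Phi ->
  X <= 12 / mu ^+ 2 * (Dt + 3 * (k * mu ^+ 4) * Bt + 6 * (k * mu ^+ 4) * S) ->
  Dt <= 2 * (k * mu ^+ 4) / mu * Phi + 18 * (k * mu ^+ 4) / mu ^+ 2 * (Bt + 2 * S) ->
  Bt = 8 * X + 6 * Dt + 12 * (k * mu ^+ 4) * A + 48 * (k * mu ^+ 4) * S
       + 18 * (k * mu ^+ 4) * Bt ->
  21 / 2 * Bt + 8 * X <= 4^-1 * A + k * (32 * 2577 * S + 3552 * Phi).
Proof.
move=> mu0 mu1 k0 k1 B0 A0 S0 Phi0 hX hD hB.
have munz : mu != 0 by rewrite gt_eqF.
have kP y : 0 <= y -> 0 <= k * y <= (3 / 640) ^+ 2 * y.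
  by move=> y0; rewrite mulr_ge0//= ler_wpM2r.
have muP n y : 0 <= y -> 0 <= y * mu ^+ n <= y.
  by move=> y0; rewrite mulr_ge0 ?exprn_ge0 ?(ltW mu0)//= ler_piMr// exprn_ile1// ltW.
have := kP _ B0; have := kP _ A0; have := kP _ S0; have := kP _ Phi0.
set kPhi := k * Phi; set kS := k * S; set kA := k * A; set kB := k * Bt.
move=> /andP[kPhi0 kPhi1] /andP[kS0 kS1] /andP[kA0 kA1] /andP[kB0 kB1].
have hD' : Dt <= mu ^+ 2 * (2 * kPhi + 18 * kB + 36 * kS).
  apply: le_trans hD _.
  have -> : 2 * (k * mu ^+ 4) / mu * Phi + 18 * (k * mu ^+ 4) / mu ^+ 2 * (Bt + 2 * S) =
    mu ^+ 2 * (2 * (kPhi * mu ^+ 1) + 18 * kB + 36 * kS).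
    by rewrite /kPhi /kB /kS; field.
  have /andP[_ H] := muP 1%N _ kPhi0.
  by rewrite ler_wpM2l ?sqr_ge0//; lra.
have hX' : X <= 24 * kPhi + 252 * kB + 504 * kS.
  apply: le_trans hX _.
  have /andP[_ H1] := muP 2%N _ kB0; have /andP[_ H2] := muP 2%N _ kS0.
  apply: (@le_trans _ _ (12 * (2 * kPhi + 18 * kB + 36 * kS) + 36 * (kB * mu ^+ 2)
                         + 72 * (kS * mu ^+ 2))); last lra.
  have -> : 12 * (2 * kPhi + 18 * kB + 36 * kS) + 36 * (kB * mu ^+ 2)
                         + 72 * (kS * mu ^+ 2) =
     12 / mu ^+ 2 * (mu ^+ 2 * (2 * kPhi + 18 * kB + 36 * kS) + 3 * (k * mu ^+ 4) * Bt
     + 6 * (k * mu ^+ 4) * S) by rewrite /kPhi /kB /kS; field.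
  by rewrite ler_pM2l ?divr_gt0 ?exprn_gt0//; lra.
have hD'' : Dt <= 2 * kPhi + 18 * kB + 36 * kS.
  have Y0 : 0 <= 2 * kPhi + 18 * kB + 36 * kS by lra.
  have /andP[_ H] := muP 2%N _ Y0; apply: le_trans hD' _; lra.
(* 8 X + 6 Dt contributes 204, 2124 and 4248; the rest comes from [hB] itself. The feedback
   coefficient 2142 k is below 1/20, so [Bt] can be solved for. *)
have hB' : Bt <= 204 * kPhi + 2142 * kB + 4296 * kS + 12 * kA.
  have /andP[_ H1] := muP 4%N _ kB0; have /andP[_ H2] := muP 4%N _ kS0.
  have /andP[_ H3] := muP 4%N _ kA0.
  rewrite hB.
  have -> : 8 * X + 6 * Dt + 12 * (k * mu ^+ 4) * A + 48 * (k * mu ^+ 4) * S +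
    18 * (k * mu ^+ 4) * Bt = 8 * X + 6 * Dt + 12 * (kA * mu ^+ 4) + 48 * (kS * mu ^+ 4) +
    18 * (kB * mu ^+ 4) by rewrite /kA /kB /kS; ring.
  lra.
have -> : k * (32 * 2577 * S + 3552 * Phi) = 32 * 2577 * kS + 3552 * kPhi.
  by rewrite /kPhi /kS; ring.
lra.
Qed.

(** Multiplying the consensus and tracker inequalities by 2 L^2/(mu N) and 2 h/(mu N) brings them to
    the form of [closed_loop_bound]. *)
Lemma feedback_rate (N E T L v gamma mu Delta C D A B phi : R) :
  let e := gamma ^+ 2 * E ^+ 2 in let h := e * L ^+ 2 in
  0 < N -> 0 < E -> 0 <= T -> 0 < L -> 0 <= v -> 0 < gamma -> 0 < mu -> mu <= 1 ->
  h / mu ^+ 4 <= (3 / 640) ^+ 2 -> 0 <= B -> 0 <= A -> 0 <= phi ->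
  mu / 2 * C <= 6 / mu * e * (D + 3 * L ^+ 2 * B + T * (6 * (N * v))) ->
  mu / 2 * D <= phi + 9 / mu * (L ^+ 2 * B + T * (2 * (N * v))) ->
  B = 8 * C + 6 * e * (D + 2 * N * A + T * (8 * (N * v))) + 18 * h * B ->
  5 / 16 * gamma * E * A <= Delta + gamma * E * (L ^+ 2 / N) * (21 / 8 * B + 2 * C)
    + T * E * (2 * L * gamma ^+ 2 * (v / N)) ->
  A <= 4 * Delta / (gamma * E) + 8 * T * L * gamma * v / N
    + gamma ^+ 2 * E ^+ 2 * L ^+ 2 / mu ^+ 4 * (32 * 2577 * (T * v) + 3552 * (phi / N)).
Proof.
have key (x y z w c : R) : w <= 4^-1 * c + z -> 5 / 4 * c <= x + w + y -> c <= x + y + z.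
  lra.
move=> e h N0 ER T0 L0 v0 gamma_gt0 mu0 mu1 loop_small B0 A0 ph0 HC HD HB Hd.
have munz : mu != 0 by rewrite gt_eqF.
have Nnz : N != 0 by rewrite gt_eqF.
have h0 : 0 <= h := mulr_ge0 (mulr_ge0 (sqr_ge0 gamma) (sqr_ge0 E)) (sqr_ge0 L).
have hk : h = h / mu ^+ 4 * mu ^+ 4 by rewrite divfK// expf_neq0.
have S0 : 0 <= T * v by rewrite mulr_ge0.
have LN : 0 <= L ^+ 2 / N by rewrite divr_ge0 ?sqr_ge0// ltW.
have := @closed_loop_bound (h / mu ^+ 4) mu (L ^+ 2 / N * C) (L ^+ 2 / N * B)
  (h / N * D) A (T * v) (phi / N) mu0 mu1.
rewrite -hk => K.
have {}K := K (divr_ge0 h0 (exprn_ge0 4 (ltW mu0))) loop_small (mulr_ge0 LN B0) A0 S0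
  (divr_ge0 ph0 (ltW N0)).
have m2 : 0 < mu / 2 by rewrite divr_gt0.
have KX : L ^+ 2 / N * C <= 12 / mu ^+ 2 * (h / N * D
    + 3 * h * (L ^+ 2 / N * B) + 6 * h * (T * v)).
  have c0 : 0 <= 2 / mu * (L ^+ 2 / N) by rewrite mulr_ge0// divr_ge0// ltW.
  have := ler_wpM2l c0 HC.
  have -> : 2 / mu * (L ^+ 2 / N) * (mu / 2 * C) = L ^+ 2 / N * C by field; rewrite Nnz.
  move=> /le_trans; apply; rewrite le_eqVlt; apply/orP; left; apply/eqP.
  by rewrite /h /e; field; rewrite Nnz.
have KD : h / N * D <= 2 * h / mu * (phi / N) + 18 * h / mu ^+ 2 *
    (L ^+ 2 / N * B + 2 * (T * v)).
  have c0 : 0 <= 2 / mu * (h / N).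
    by rewrite mulr_ge0 ?divr_ge0// ltW.
  have := ler_wpM2l c0 HD.
  have -> : 2 / mu * (h / N) * (mu / 2 * D) = h / N * D by field; rewrite Nnz.
  move=> /le_trans; apply; rewrite le_eqVlt; apply/orP; left; apply/eqP.
  by field; rewrite Nnz.
have KB : L ^+ 2 / N * B = 8 * (L ^+ 2 / N * C) + 6 * (h / N * D) + 12 * h * A
    + 48 * h * (T * v) + 18 * h * (L ^+ 2 / N * B).
  by rewrite {1}HB /h /e; field.
have {K KX KD KB} K := K KX KD KB.
have gE : 0 < gamma * E by rewrite mulr_gt0.
(* This factor turns 5/16 gamma E into 5/4; the feedback returns at most a quarter of [A], which
   leaves coefficient 1. *)
have c4 : 0 <= 4 / (gamma * E) by rewrite divr_ge0// ltW.
have {}Hd := ler_wpM2l c4 Hd.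
have e1 : 4 / (gamma * E) * (5 / 16 * gamma * E * A) = 5 / 4 * A.
  by field; rewrite !gt_eqF.
have e2 : 4 / (gamma * E) * (Delta + gamma * E * (L ^+ 2 / N) *
    (21 / 8 * B + 2 * C) + T * E * (2 * L * gamma ^+ 2 * (v / N))) =
  4 * Delta / (gamma * E) + (21 / 2 * (L ^+ 2 / N * B)
    + 8 * (L ^+ 2 / N * C)) + 8 * T * L * gamma * v / N.
  by field; rewrite Nnz !gt_eqF.
rewrite e1 e2 in Hd.
exact: key K Hd.
Qed.

End recursion.

(** * Moments of the iterates *)

Section lsgt_moments.
Variables (R : realType) (N p b : nat) (W : 'M[R]_N) (lam : R).
Hypothesis N0 : (0 < N)%N.
Hypothesis W1 : W *m (const_mx 1 : 'cV[R]_N) = const_mx 1.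
Hypothesis W2 : (const_mx 1 : 'rV[R]_N) *m W = const_mx 1.
Hypothesis opW : forall X : 'M[R]_(N, p),
  sqn ((W - N%:R^-1 *: const_mx 1) *m X) <= lam ^+ 2 * sqn X.
Hypothesis lam1 : lam ^+ 2 < 1.
Variables (dX : measure_display) (Xi : 'I_N -> measurableType dX).
Variables (l : forall n, 'rV[R]_p -> Xi n -> R) (f : 'I_N -> 'rV[R]_p -> R).
Hypothesis ml : forall n y, measurable_fun setT (l y : Xi n -> R).
Hypothesis dl : forall n (x : Xi n) y, differentiable (fun z => l z x) y.
Hypothesis df : forall n y, differentiable (f n) y.
Variables (L v : R).
Hypothesis L0 : 0 < L.
Hypothesis f_lip : forall n y y',
  sqn (gradient (f n) y - gradient (f n) y') <= L ^+ 2 * sqn (y - y').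
Variables (E T : nat) (gamma : R) (y0 : 'rV[R]_p).
Hypothesis E0 : (0 < E)%N.
Context {dO : measure_display} {Omega : measurableType dO}.
Variables (P : probability Omega R) (I : forall n, nat -> Omega -> b.-tuple (Xi n)).
Let M := (T.+1 * E)%N.
Hypothesis mI : forall n k, (k <= M)%N -> measurable_fun setT (I n k).
Hypothesis indepI : @mutually_independent _ _ Omega R P ('I_N * 'I_M.+1)%type
  (fun nk => b.-tuple (Xi nk.1)) (fun nk => I nk.1 nk.2).
Hypothesis unbiased : forall n k y i, (k <= M)%N ->
  'E_P[fun w => (minibatch_gradient l y (I n k w) 0%R i : R)]%E
  = (gradient (f n) y 0 i)%:E.
Hypothesis var_le : forall n k y, (k <= M)%N ->
  ('E_P[fun w => (fnorm (minibatch_gradient l y (I n k w) - gradient (f n) y) ^+ 2)%R]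
   <= v%:E)%E.

Let Z r q w := round_y l W E gamma y0 (fun n k => I n k w) r q.
Let G r q w := round_g l W E gamma y0 (fun n k => I n k w) r q.
Let V r w := round_v l W E gamma y0 (fun n k => I n k w) r.
Let AG := agent_gradients f.
Let F y := N%:R^-1 * \sum_(n < N) f n y.

Definition noise r q w := G r q w - AG (Z r q w).

Let NR : 0 < N%:R :> R. Proof. by rewrite ltr0n. Qed.

Let row_noise n r q w :
  row n (noise r q w) = sample_noise l f I n (r * E + q) (fun w => row n (Z r q w)) w.
Proof. by rewrite /noise /G round_gE// linearB /= !rowK. Qed.

(** Batch [r * E + q] is first used after [Z r q] is formed, for every agent, so the iterate is a
    function of the other batches. *)
Let measurable_Z_others n r q (H : (r * E + q <= M)%N) :
  measurable_mx (Z r q : others I n H -> _).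
Proof.
apply: measurable_round_y => // n' k kH; apply: measurable_others => //.
  by rewrite (leq_trans _ H)// ltnW.
by rewrite orbC ltn_eqF.
Qed.

Let noise_var n r q : (r * E + q <= M)%N ->
  sq_integrable P (fun w => row n (noise r q w)) /\
  \int[P]_w sqn (row n (noise r q w)) <= v.
Proof.
move=> H; have [] := sample_noise_var ml dl L0 f_lip mI indepI var_le (n := n) (kM := H)
  (Y := fun w => row n (Z r q w)).
  by apply: measurable_mx_row; exact: measurable_Z_others.
move=> s1 s2; split; first by under eq_fun do rewrite row_noise.
by under eq_Rintegral do rewrite row_noise.
Qed.

Lemma sq_integrable_noise r q : (r * E + q <= M)%N -> sq_integrable P (noise r q).
Proof. by move=> H; apply: sq_integrable_of_rows => n; have [] := noise_var n H. Qed.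

Lemma noise_sqn_le r q : (r * E + q <= M)%N ->
  \int[P]_w sqn (noise r q w) <= N%:R * v.
Proof.
move=> H; under eq_Rintegral do rewrite sqn_row.
rewrite Rintegral_sum; last by move=> n; case: (noise_var n H) => -[].
apply: (@le_trans _ _ (\sum_(n < N) v)).
  by apply: ler_sum => n _; case: (noise_var n H).
by rewrite sumr_const card_ord mulr_natl.
Qed.

Let mdot_suml (s : seq 'I_N) (A : 'I_N -> 'rV[R]_p) (B : 'rV[R]_p) :
  mdot (\sum_(n <- s) A n) B = \sum_(n <- s) mdot (A n) B.
Proof.
elim: s => [|n s IH]; last by rewrite !big_cons mdotDl IH.
by rewrite !big_nil -(scale0r 0) mdotZl mul0r.
Qed.

(* Distinct agents have uncorrelated noise, so averaging divides the variance by N. *)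
Lemma noise_row_mean_sqn_le r q : (r * E + q <= M)%N ->
  \int[P]_w sqn (row_mean (noise r q w)) <= v / N%:R.
Proof.
move=> H.
have imd n m : integrable_rv P (fun w => mdot (row n (noise r q w)) (row m (noise r q w))).
  by apply: integrable_mdot; [case: (noise_var n H)|case: (noise_var m H)].
have E1 w : sqn (row_mean (noise r q w)) = N%:R^-1 ^+ 2 *
    \sum_(n < N) \sum_(m < N) mdot (row n (noise r q w)) (row m (noise r q w)).
  rewrite /row_mean sqnZ -mdotvv mdot_suml; congr (_ * _).
  by apply: eq_bigr => n _; rewrite mdotC mdot_suml; apply: eq_bigr => m _; rewrite mdotC.
under eq_Rintegral do rewrite E1.
rewrite RintegralZl//; last first.
  exact: (integrable_rv_sum _ (fun n => integrable_rv_sum _ (imd n))).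
rewrite Rintegral_sum; last by move=> n; exact: (integrable_rv_sum _ (imd n)).
apply: (@le_trans _ _ (N%:R^-1 ^+ 2 * (N%:R * v))); last first.
  by rewrite le_eqVlt; apply/orP; left; apply/eqP; field; rewrite gt_eqF.
rewrite ler_wpM2l ?sqr_ge0//; apply: (@le_trans _ _ (\sum_(n < N) v)).
  apply: ler_sum => n _; rewrite Rintegral_sum; last by move=> m; exact: imd.
  rewrite (bigD1 n)//= big1 ?addr0.
    by under eq_Rintegral do rewrite mdotvv; case: (noise_var n H).
  move=> m mn; under eq_Rintegral do rewrite mdotC (row_noise n).
  apply: (sample_noise_orthogonal ml dl L0 f_lip mI indepI unbiased var_le (kM := H)).
  - by apply: measurable_mx_row; exact: measurable_Z_others.
  - have -> : (fun w => row m (noise r q w)) =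
        sample_noise l f I m (r * E + q) (fun w => row m (Z r q w)).
      by apply/funext => w; exact: row_noise.
    have mZm : measurable_mx ((fun w => row m (Z r q w)) : others I n H -> _).
      by apply: measurable_mx_row; exact: measurable_Z_others.
    apply: measurable_mxB; last exact: measurable_lipschitz_gradient (f_lip m) _.
    by apply: measurable_minibatch_gradient => //; apply: measurable_others => //; rewrite mn.
  - by case: (noise_var m H).
by rewrite sumr_const card_ord mulr_natl.
Qed.

Let mix_sqn_le (X : 'M[R]_(N, p)) : sqn (W *m X) <= sqn X.
Proof.
rewrite (sqn_consensus_split N0) [leRHS](sqn_consensus_split N0) (row_mean_mix W2) lerD2r.
by apply: sqn_mix_consensus_le.
Qed.

Let sq_integrable_mix (A : Omega -> 'M[R]_(N, p)) :
  sq_integrable P A -> sq_integrable P (fun w => W *m A w).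
Proof.
move=> sA; apply: (@sq_integrable_le _ _ _ _ _ _ _ _ _ A 1 0) => //.
  by apply: measurable_mx_mull; case: sA.
by move=> w; rewrite mul1r addr0.
Qed.

Let sq_integrable_AG (A : Omega -> 'M[R]_(N, p)) :
  sq_integrable P A -> sq_integrable P (fun w => AG (A w)).
Proof.
move=> sA; apply: (@sq_integrable_le _ _ _ _ _ _ _ _ _ A (2 * L ^+ 2) (2 * sqn (AG 0))) => //.
  by apply: measurable_agent_gradients f_lip _ => //; case: sA.
move=> w; have := sqnD_le (AG (A w) - AG 0) (AG 0); rewrite subrK.
by have := agent_gradients_lip f_lip (A w) 0; rewrite subr0 -/AG; lra.
Qed.

Let sq_integrable_G_of_Z r q : (r * E + q <= M)%N ->
  sq_integrable P (Z r q) -> sq_integrable P (G r q).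
Proof.
move=> H sZ; have := sq_integrableD (sq_integrable_noise H) (sq_integrable_AG sZ).
by rewrite /noise; under eq_fun do rewrite subrK.
Qed.

Let range r q : (r < T)%N -> (q <= E)%N -> (r * E + q <= M)%N.
Proof.
move=> rT qE; rewrite /M mulSn addnC leq_add// leq_mul2r orbC.
by rewrite (ltnW rT).
Qed.

(** Strong induction on [q]: the unrolled iterate contains all gradients [G r j] with [j < q], whose
    integrability rests on that of [Z r j]. *)
Let sq_integrable_Z_round r : (r < T)%N ->
  sq_integrable P (Z r 0) -> sq_integrable P (V r) ->
  forall q, (q <= E)%N -> sq_integrable P (Z r q).
Proof.
move=> rT sZ sV q; elim/ltn_ind: q => -[//|q] IH qE.
have ZE w : Z r q.+1 w = W *m Z r 0 w - gamma *:
    (q.+1%:R *: (W *m V r w) + \sum_(j < q.+1) (G r j w - G r 0 w)).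
  by rewrite /Z round_yE.
have -> : Z r q.+1 = fun w => W *m Z r 0 w - gamma *:
    (q.+1%:R *: (W *m V r w) + \sum_(j < q.+1) (G r j w - G r 0 w)) by exact/funext.
apply: sq_integrableB; first exact: sq_integrable_mix.
apply: sq_integrableZ; apply: sq_integrableD.
  by apply: sq_integrableZ; exact: sq_integrable_mix.
have sG j : (j < q.+1)%N -> sq_integrable P (G r j).
  move=> jq; have jE : (j <= E)%N by rewrite (leq_trans _ qE)// ltnW.
  by apply: sq_integrable_G_of_Z; [exact: range|exact: IH].
by apply: sq_integrable_sum => j; apply: sq_integrableB; exact: sG.
Qed.

Lemma sq_integrable_round r : (r <= T)%N ->
  sq_integrable P (Z r 0) /\ sq_integrable P (V r).
Proof.
elim: r => [_|r IH rT].
  have sZ : sq_integrable P (Z 0 0) by exact: sq_integrable_cst.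
  by split => //; exact: (@sq_integrable_G_of_Z 0 0).
have [sZ sV] := IH (ltnW rT).
have sZq := sq_integrable_Z_round rT sZ sV.
split.
  rewrite (_ : Z r.+1 0 = Z r E); first exact: sZq.
  by apply/funext => w; rewrite /Z round_y_next.
rewrite (_ : V r.+1 = fun w => W *m V r w + G r E w - G r 0 w); last first.
  by apply/funext => w; rewrite /V round_v_next.
apply: sq_integrableB; last by apply: sq_integrable_G_of_Z (sZq _ _) => //; exact: range.
apply: sq_integrableD; first exact: sq_integrable_mix.
by apply: sq_integrable_G_of_Z (sZq _ _) => //; exact: range.
Qed.

Lemma sq_integrable_Z r q : (r < T)%N -> (q <= E)%N -> sq_integrable P (Z r q).
Proof.
move=> rT qE; have [sZ sV] := sq_integrable_round (ltnW rT).
exact: sq_integrable_Z_round.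
Qed.

Lemma sq_integrable_G r q : (r < T)%N -> (q <= E)%N -> sq_integrable P (G r q).
Proof.
by move=> rT qE; apply: sq_integrable_G_of_Z; [exact: range|exact: sq_integrable_Z].
Qed.

Let C r := \int[P]_w sqn (consensus_error (Z r 0 w)).
Let D r := \int[P]_w sqn (consensus_error (V r w)).
Let a r := \int[P]_w sqn (row_mean (AG (Z r 0 w))).
Let u r q := \int[P]_w sqn (Z r q w - Z r 0 w).
Let g r q := \int[P]_w sqn (G r q w - G r 0 w).
Let sum_change r q w : R := \sum_(j < q) sqn (G r j w - G r 0 w).
Let sum_g r q : R := \sum_(j < q) g r j.

Let sq_integrable_consensus (A : Omega -> 'M[R]_(N, p)) :
  sq_integrable P A -> sq_integrable P (fun w => consensus_error (A w)).
Proof.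
move=> sA; apply: (@sq_integrable_le _ _ _ _ _ _ _ _ _ A 1 0) => //.
  by apply: measurable_mx_consensus; case: sA.
by move=> w; rewrite mul1r addr0 sqn_consensus_error_le.
Qed.

Let sq_integrable_row_mean (A : Omega -> 'M[R]_(N, p)) :
  sq_integrable P A -> sq_integrable P (fun w => row_mean (A w)).
Proof.
move=> sA; apply: (@sq_integrable_le _ _ _ _ _ _ _ _ _ A N%:R^-1 0) => //.
  by apply: measurable_mx_row_mean; case: sA.
by move=> w; rewrite addr0 mulrC ler_pdivlMr// mulrC sqn_row_mean_le.
Qed.

(* Conversion between distinct integrals can diverge in practice, so they are
   turned into variables before calling lra. *)
Ltac lra_atoms :=
  repeat match goal with
  | H : context [Rintegral _ _ _] |- _ => revert H
  | H : context [bigop.body _ _ _] |- _ => revert H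
  | H : context [C _] |- _ => revert H
  | H : context [D _] |- _ => revert H
  | H : context [a _] |- _ => revert H
  | H : context [u _ _] |- _ => revert H
  | H : context [g _ _] |- _ => revert H
  end;
  repeat match goal with
  | |- context [@Rintegral ?x ?y ?z ?m ?D ?f] => generalize (@Rintegral x y z m D f); intro
  | |- context [@bigop.body ?t ?i ?x ?y ?z] => generalize (@bigop.body t i x y z); intro
  | |- context [C ?r] => generalize (C r); intro
  | |- context [D ?r] => generalize (D r); intro
  | |- context [a ?r] => generalize (a r); intro
  | |- context [u ?r ?q] => generalize (u r q); intro
  | |- context [g ?r ?q] => generalize (g r q); intro
  | |- context [sum_change ?x ?y ?z] => generalize (sum_change x y z); intro
  | |- context [sum_g ?x ?y] => generalize (sum_g x y); intro
  | |- context [F ?x] => generalize (F x); intro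
  | |- context [@sqn ?r ?m ?n ?x] => generalize (@sqn r m n x); intro
  | |- context [@mdot ?r ?m ?n ?x ?y] => generalize (@mdot r m n x y); intro
  end; intros; lra.

Let s2 := N%:R * v.

Let gradient_change_le r q : (r < T)%N -> (q <= E)%N ->
  g r q <= 3 * (L ^+ 2 * u r q + 2 * s2).
Proof.
move=> rT qE.
have sq := sq_integrable_Z rT qE; have s0 := sq_integrable_Z rT (leq0n E).
have nq := noise_sqn_le (range rT qE); have n0 := noise_sqn_le (range rT (leq0n E)).
apply: (@le_trans _ _ (3 * L ^+ 2 * u r q + (3 * \int[P]_w sqn (noise r q w) +
    (3 * \int[P]_w sqn (noise r 0 w) + 0)))); last by rewrite /s2; lra_atoms.
have := @le_Rintegral_comb _ _ _ P (fun w => sqn (G r q w - G r 0 w))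
  [:: (3 * L ^+ 2, fun w => sqn (Z r q w - Z r 0 w)); (3, fun w => sqn (noise r q w));
      (3, fun w => sqn (noise r 0 w))].
rewrite !big_cons big_nil /=; apply.
- by have [] := sq_integrableB (sq_integrable_G rT qE) (sq_integrable_G rT (leq0n E)).
- split; first by have [] := sq_integrableB sq s0.
  split; first by have [] := sq_integrable_noise (range rT qE).
  by split => //; have [] := sq_integrable_noise (range rT (leq0n E)).
- move=> w; rewrite !big_cons big_nil /=.
  by have := gradient_change f_lip (Z r q w) (Z r 0 w) (G r q w) (G r 0 w);
    rewrite -/AG -/(noise r q w) -/(noise r 0 w); lra_atoms.
Qed.

Let e := gamma ^+ 2 * E%:R ^+ 2.
Let h := e * L ^+ 2.

Let u0 r : u r 0 = 0.
Proof.
rewrite /u; under eq_Rintegral do rewrite subrr sqn0.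
by rewrite Rintegral_cst// mul0r.
Qed.

Let integral_sum_change r q : (r < T)%N -> (q <= E)%N ->
  integrable_rv P (fun w => sum_change r q w) /\
  \int[P]_w (sum_change r q w) = sum_g r q.
Proof.
move=> rT qE.
have i_j (j : 'I_q) : integrable_rv P (fun w => sqn (G r j w - G r 0 w)).
  have jE : (j <= E)%N by rewrite (leq_trans _ qE)// ltnW.
  by have [] := sq_integrableB (sq_integrable_G rT jE) (sq_integrable_G rT (leq0n E)).
by split; [exact: integrable_rv_sum|rewrite Rintegral_sum].
Qed.

Let drift_le r q : (r < T)%N -> (0 < q)%N -> (q <= E)%N ->
  u r q <= 8 * C r + 6 * e * (D r + 2 * N%:R * a r + 2 * s2)
    + 6 * gamma ^+ 2 * E%:R * sum_g r q.
Proof.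
move=> rT q0 qE.
have sq := sq_integrable_Z rT qE; have s0 := sq_integrable_Z rT (leq0n E).
have [_ sV] := sq_integrable_round (ltnW rT).
have n0 := noise_sqn_le (range rT (leq0n E)).
have [iS eS] := integral_sum_change rT qE.
have e0 : 0 <= e by rewrite mulr_ge0 ?sqr_ge0.
have := @le_Rintegral_comb _ _ _ P (fun w => sqn (Z r q w - Z r 0 w))
  [:: (8, fun w => sqn (consensus_error (Z r 0 w)));
      (6 * e, fun w => sqn (consensus_error (V r w)));
      (6 * e * (2 * N%:R), fun w => sqn (row_mean (AG (Z r 0 w))));
      (6 * e * 2, fun w => sqn (noise r 0 w));
      (6 * gamma ^+ 2 * E%:R, fun w => sum_change r q w)].
rewrite !big_cons big_nil /= eS => H.
have {}H : u r q <= 8 * C r + (6 * e * D r + (6 * e * (2 * N%:R) * a r +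
    (6 * e * 2 * \int[P]_w sqn (noise r 0 w) +
    (6 * gamma ^+ 2 * E%:R * sum_g r q + 0)))).
  apply: H.
  - by have [] := sq_integrableB sq s0.
  - split; first by have [] := sq_integrable_consensus s0.
    split; first by have [] := sq_integrable_consensus sV.
    split; first by have [] := sq_integrable_row_mean (sq_integrable_AG s0).
    by split; first by have [] := sq_integrable_noise (range rT (leq0n E)).
  - move=> w; rewrite !big_cons big_nil /=.
    have meanV : row_mean (V r w) = row_mean (G r 0 w) by exact: row_mean_round_v.
    have : sqn (Z r q w - Z r 0 w) <= 8 * sqn (consensus_error (Z r 0 w)) +
        6 * gamma ^+ 2 * E%:R ^+ 2 * (sqn (consensus_error (V r w)) +
          2 * N%:R * sqn (row_mean (AG (Z r 0 w))) + 2 * sqn (noise r 0 w))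
        + 6 * gamma ^+ 2 * E%:R * sum_change r q w.
      rewrite {1}/Z round_yE//.
      exact: (drift_bound gamma N0 W1 W2 opW lam1 f (Z r 0 w)
        (fun j => G r j w - G r 0 w) qE meanV).
    by rewrite /e; lra_atoms.
by have := ler_wpM2l e0 n0; rewrite -/s2; lra_atoms.
Qed.

Hypothesis h_small : 18 * h < 1.

(* The fixed point of the within-round drift recursion. *)
Definition drift_sup r := (8 * C r + 6 * e * (D r + 2 * N%:R * a r + 8 * s2)) / (1 - 18 * h).

Let drift_supE r : drift_sup r =
  8 * C r + 6 * e * (D r + 2 * N%:R * a r + 8 * s2) + 18 * h * drift_sup r.
Proof. by rewrite /drift_sup; field; rewrite gt_eqF// subr_gt0. Qed.

Hypothesis v0 : 0 <= v.

Let sqn_integral_ge0 m n (A : Omega -> 'M[R]_(m, n)) : 0 <= \int[P]_w sqn (A w).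
Proof. by apply: Rintegral_ge0 => w _; exact: sqn_ge0. Qed.

Let s20 : 0 <= s2. Proof. by rewrite mulr_ge0// ltW. Qed.

Let e0 : 0 <= e. Proof. by rewrite mulr_ge0 ?sqr_ge0. Qed.

Lemma drift_sup_ge0 r : 0 <= drift_sup r.
Proof.
rewrite divr_ge0 ?subr_ge0 ?(ltW h_small)// addr_ge0// mulr_ge0 ?sqn_integral_ge0//.
  by rewrite mulr_ge0.
have D0 : 0 <= D r by exact: sqn_integral_ge0.
have a0 : 0 <= N%:R * a r by rewrite mulr_ge0 ?sqn_integral_ge0// ltW.
by have := s20; lra_atoms.
Qed.

(** Strong induction on [q], starting from zero drift. If the earlier drifts are at most B, the
    gradient changes add 18 h B + 36 e s2 to [drift_le]; with its own 12 e s2 this is the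
    fixed-point equation, whence the 8 = 2 + 6 in [drift_sup]. *)
Let drift_sup_le r q : (r < T)%N -> (q <= E)%N -> u r q <= drift_sup r.
Proof.
move=> rT; elim/ltn_ind: q => -[|q] IH qE; first by rewrite u0 drift_sup_ge0.
apply: le_trans (drift_le rT _ qE) _ => //.
have gB : sum_g r q.+1 <= E%:R * (3 * (L ^+ 2 * drift_sup r + 2 * s2)).
  apply: (@le_trans _ _ (\sum_(j < q.+1) (3 * (L ^+ 2 * drift_sup r + 2 * s2)))).
    apply: ler_sum => j _.
    have jE : (j <= E)%N by rewrite (leq_trans _ qE)// ltnW.
    apply: le_trans (gradient_change_le rT jE) _.
    by rewrite ler_wpM2l// lerD2r; apply: ler_wpM2l; [exact: sqr_ge0|exact: IH].
  rewrite sumr_const card_ord -[leLHS]mulr_natl ler_wpM2r ?ler_nat//.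
  by rewrite mulr_ge0// addr_ge0// mulr_ge0 ?drift_sup_ge0// exprn_ge0// ltW.
have K : 0 <= 6 * gamma ^+ 2 * E%:R.
  exact: (mulr_ge0 (mulr_ge0 (ler0n _ 6) (sqr_ge0 gamma)) (ler0n _ E)).
have := ler_wpM2l K gB; have := drift_supE r; rewrite /h /e.
by move: (drift_sup r) => B; lra_atoms.
Qed.

Let sum_change_le r : (r < T)%N ->
  sum_g r E <= E%:R * (3 * (L ^+ 2 * drift_sup r + 2 * s2)).
Proof.
move=> rT; apply: (@le_trans _ _ (\sum_(j < E) (3 * (L ^+ 2 * drift_sup r + 2 * s2)))).
  apply: ler_sum => j _; apply: le_trans (gradient_change_le rT (ltnW (ltn_ord j))) _.
  rewrite ler_wpM2l// lerD2r; apply: ler_wpM2l; first exact: sqr_ge0.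
  by apply: drift_sup_le => //; exact: ltnW.
by rewrite sumr_const card_ord -[leLHS]mulr_natl.
Qed.

Let mu := 1 - lam ^+ 2.
Let mu0 : 0 < mu. Proof. by rewrite subr_gt0. Qed.

Lemma consensus_v_recursion r : (r < T)%N ->
  D r.+1 <= (1 - mu / 2) * D r + 9 / mu * (L ^+ 2 * drift_sup r + 2 * s2).
Proof.
move=> rT; have [_ sV] := sq_integrable_round (ltnW rT).
have [_ sV'] := sq_integrable_round rT.
apply: (@le_trans _ _ ((1 - mu / 2) * D r + (3 / mu * g r E + 0))); last first.
  rewrite addr0 lerD2l.
  have m0 : 0 <= 3 / mu by rewrite divr_ge0// ltW.
  have := ler_wpM2l m0 (gradient_change_le rT (leqnn E)).
  have L2 := ler_wpM2l (sqr_ge0 L) (drift_sup_le rT (leqnn E)).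
  have := ler_wpM2l m0 L2; lra_atoms.
have := @le_Rintegral_comb _ _ _ P (fun w => sqn (consensus_error (V r.+1 w)))
  [:: (1 - mu / 2, fun w => sqn (consensus_error (V r w)));
      (3 / mu, fun w => sqn (G r E w - G r 0 w))].
rewrite !big_cons big_nil /=; apply.
- by have [] := sq_integrable_consensus sV'.
- split; first by have [] := sq_integrable_consensus sV.
  by have [] := sq_integrableB (sq_integrable_G rT (leqnn E)) (sq_integrable_G rT (leq0n E)).
- move=> w; rewrite !big_cons big_nil /= /V round_v_next// addr0.
  exact: consensus_v_step.
Qed.

Lemma consensus_y_recursion r : (r < T)%N ->
  C r.+1 <= (1 - mu / 2) * C r + 6 / mu * e * (D r + 3 * L ^+ 2 * drift_sup r + 6 * s2).
Proof.
move=> rT; have [sZ sV] := sq_integrable_round (ltnW rT).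
have [sZ' _] := sq_integrable_round rT.
have [iS eS] := integral_sum_change rT (leqnn E).
have m0 : 0 <= 6 / mu * gamma ^+ 2 * E%:R.
  by rewrite mulr_ge0// mulr_ge0 ?sqr_ge0// divr_ge0// ltW.
apply: (@le_trans _ _ ((1 - mu / 2) * C r + (6 / mu * e * D r +
    (6 / mu * gamma ^+ 2 * E%:R * sum_g r E + 0)))); last first.
  by have := ler_wpM2l m0 (sum_change_le rT); rewrite /e; lra_atoms.
have := @le_Rintegral_comb _ _ _ P (fun w => sqn (consensus_error (Z r.+1 0 w)))
  [:: (1 - mu / 2, fun w => sqn (consensus_error (Z r 0 w)));
      (6 / mu * e, fun w => sqn (consensus_error (V r w)));
      (6 / mu * gamma ^+ 2 * E%:R, fun w => sum_change r E w)].
rewrite !big_cons big_nil /= eS; apply.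
- by have [] := sq_integrable_consensus sZ'.
- split; first by have [] := sq_integrable_consensus sZ.
  by split; first by have [] := sq_integrable_consensus sV.
- move=> w; rewrite !big_cons big_nil /=.
  have -> : Z r.+1 0 w = W *m Z r 0 w - gamma *: (E%:R *: (W *m V r w) +
      \sum_(j < E) (G r j w - G r 0 w)) by rewrite {1}/Z round_y_next// round_yE.
  have : sqn (consensus_error (W *m Z r 0 w - gamma *: (E%:R *: (W *m V r w) +
      \sum_(j < E) (G r j w - G r 0 w)))) <=
      (1 - mu / 2) * sqn (consensus_error (Z r 0 w)) + 6 / mu * gamma ^+ 2 *
      (E%:R ^+ 2 * sqn (consensus_error (V r w)) + E%:R * sum_change r E w).
    exact: (consensus_y_step gamma N0 W1 W2 opW lam1 (Z r 0 w) (V r w) E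
      (fun j => G r j w - G r 0 w)).
  by rewrite /e; lra_atoms.
Qed.

Let change r q w := - (5 / 16 * gamma) * sqn (row_mean (AG (Z r 0 w)))
    + gamma * (L ^+ 2 / N%:R) * (21 / 8 * sqn (Z r q w - Z r 0 w)
        + 2 * sqn (consensus_error (Z r 0 w)))
    - gamma * mdot (gradient F (row_mean (Z r q w))) (row_mean (noise r q w))
    + 2 * L * gamma ^+ 2 * sqn (row_mean (noise r q w)).

Hypothesis gamma_gt0 : 0 < gamma.
Let gamma0 : 0 <= gamma := ltW gamma_gt0.
Hypothesis gammaL : 2 * L * gamma <= 8^-1.

Let F_step r q w : F (row_mean (Z r q.+1 w)) <= F (row_mean (Z r q w)) + change r q w.
Proof.
have -> : row_mean (Z r q.+1 w) = row_mean (Z r q w) - gamma *: row_mean (G r q w).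
  exact: row_mean_round_y.
have : F (row_mean (Z r q w) - gamma *: row_mean (G r q w)) <= F (row_mean (Z r q w))
    - 5 / 16 * gamma * sqn (row_mean (AG (Z r 0 w)))
    + gamma * (L ^+ 2 / N%:R) * (21 / 8 * sqn (Z r q w - Z r 0 w)
        + 2 * sqn (consensus_error (Z r 0 w)))
    - gamma * mdot (gradient F (row_mean (Z r q w))) (row_mean (noise r q w))
    + 2 * L * gamma ^+ 2 * sqn (row_mean (noise r q w)).
  exact: descent_step.
by rewrite /change; lra_atoms.
Qed.

Let F_rounds w t : F (row_mean (Z t 0 w)) <=
  F y0 + \sum_(r < t) \sum_(q < E) change r q w.
Proof.
have inner r q : F (row_mean (Z r q w)) <=
    F (row_mean (Z r 0 w)) + \sum_(j < q) change r j w.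
  elim: q => [|q IH]; first by rewrite big_ord0 addr0.
  by rewrite big_ord_recr addrA; apply: le_trans (F_step _ _ _) _; rewrite lerD2r.
elim: t => [|t IH]; first by rewrite big_ord0 addr0 /Z row_mean_round_y00.
rewrite big_ord_recr addrA {1}/Z round_y_next//.
by apply: le_trans (inner t E) _; rewrite lerD2r.
Qed.

Let sq_integrable_gradient_mean (A : Omega -> 'M[R]_(N, p)) :
  sq_integrable P A -> sq_integrable P (fun w => gradient F (row_mean (A w))).
Proof.
move=> sA; have sm := sq_integrable_row_mean sA.
have flip := gradient_average_lip N0 df f_lip.
apply: (@sq_integrable_le _ _ _ _ _ _ _ _ _ (fun w => row_mean (A w))
  (2 * L ^+ 2) (2 * sqn (gradient F 0))) => //.
  by apply: measurable_lipschitz_gradient flip _ => //; case: sm.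
move=> w; have := sqnD_le (gradient F (row_mean (A w)) - gradient F 0) (gradient F 0).
by rewrite subrK; have := flip (row_mean (A w)) 0; rewrite subr0 -/F; lra_atoms.
Qed.

(** The mean noise is split into agents, because [sample_noise_orthogonal] handles one batch at a
    time against a variable that does not depend on it. *)
Let orthogonal r q : (r < T)%N -> (q <= E)%N ->
  \int[P]_w mdot (gradient F (row_mean (Z r q w))) (row_mean (noise r q w)) = 0.
Proof.
move=> rT qE; have H := range rT qE.
have sZ := sq_integrable_Z rT qE; have sF := sq_integrable_gradient_mean sZ.
have E1 w : mdot (gradient F (row_mean (Z r q w))) (row_mean (noise r q w)) =
    N%:R^-1 * \sum_(n < N) mdot (gradient F (row_mean (Z r q w))) (row n (noise r q w)).
  rewrite mdotZr mdotC mdot_suml; congr (_ * _).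
  by apply: eq_bigr => n _; rewrite mdotC.
have i1 n : integrable_rv P
    (fun w => mdot (gradient F (row_mean (Z r q w))) (row n (noise r q w))).
  by apply: integrable_mdot => //; case: (noise_var n H).
under eq_Rintegral do rewrite E1.
rewrite RintegralZl//; last exact: (integrable_rv_sum _ i1).
rewrite Rintegral_sum// big1 ?mulr0// => n _.
under eq_Rintegral do rewrite row_noise.
apply: (sample_noise_orthogonal ml dl L0 f_lip mI indepI unbiased var_le (kM := H)).
- by apply: measurable_mx_row; exact: measurable_Z_others.
- apply: measurable_lipschitz_gradient (gradient_average_lip N0 df f_lip) _ => //.
  by apply: measurable_mx_row_mean; exact: measurable_Z_others.
- exact: sF.
Qed.

Let eq_le_refl (x y : R) : x = y -> x <= y. Proof. by move=> ->. Qed.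

Let change_le r q : (r < T)%N -> (q < E)%N -> integrable_rv P (change r q) /\
  \int[P]_w change r q w <= - (5 / 16 * gamma) * a r
    + gamma * (L ^+ 2 / N%:R) * (21 / 8 * drift_sup r + 2 * C r)
    + 2 * L * gamma ^+ 2 * (v / N%:R).
Proof.
move=> rT /ltnW qE; have H := range rT qE.
have sZ := sq_integrable_Z rT qE; have sZ0 := sq_integrable_Z rT (leq0n E).
have sn := sq_integrable_row_mean (sq_integrable_noise H).
set s := [:: (- (5 / 16 * gamma), fun w => sqn (row_mean (AG (Z r 0 w))));
      (gamma * (L ^+ 2 / N%:R) * (21 / 8), fun w => sqn (Z r q w - Z r 0 w));
      (gamma * (L ^+ 2 / N%:R) * 2, fun w => sqn (consensus_error (Z r 0 w)));
      (- gamma, fun w => mdot (gradient F (row_mean (Z r q w))) (row_mean (noise r q w)));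
      (2 * L * gamma ^+ 2, fun w => sqn (row_mean (noise r q w)))].
have is_ : foldr (fun cY Q => integrable_rv P cY.2 /\ Q) True s.
  split; first by have [] := sq_integrable_row_mean (sq_integrable_AG sZ0).
  split; first by have [] := sq_integrableB sZ sZ0.
  split; first by have [] := sq_integrable_consensus sZ0.
  split; first by apply: integrable_mdot => //; exact: sq_integrable_gradient_mean.
  by split => //; case: sn.
have eqs w : change r q w = \sum_(cY <- s) cY.1 * cY.2 w.
  by rewrite /s !big_cons big_nil /= /change; ring.
have ic : integrable_rv P (change r q).
  have -> : change r q = fun w => \sum_(cY <- s) cY.1 * cY.2 w by exact/funext.
  rewrite /s; case: is_ => i1 [i2 [i3 [i4 [i5 _]]]].
  under eq_fun do rewrite !big_cons big_nil /=.
  do 5 (apply: integrable_rvD; first exact: integrable_rvZ).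
  exact: integrable_rv_cst.
split => //.
have := le_Rintegral_comb ic is_ (fun w => eq_le_refl (eqs w)).
rewrite /s !big_cons big_nil /= orthogonal// -/(a r) -/(u r q) -/(C r).
have u_le := drift_sup_le rT qE.
have n_le := noise_row_mean_sqn_le H.
have c0 : 0 <= gamma * (L ^+ 2 / N%:R) * (21 / 8).
  by rewrite mulr_ge0// mulr_ge0// divr_ge0// ?sqr_ge0// ltW.
have c1 : 0 <= 2 * L * gamma ^+ 2 by rewrite mulr_ge0 ?sqr_ge0// mulr_ge0// ltW.
have := ler_wpM2l c0 u_le; have := ler_wpM2l c1 n_le.
by move: (drift_sup r) => B; lra_atoms.
Qed.

(** The one-step bounds are summed along each sample path and [F] at the final iterate is replaced
    by its lower bound before integrating, so [F] at a random point never enters an integral. *)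
Lemma lsgt_descent (Flow : R) : (forall y, Flow <= F y) ->
  5 / 16 * gamma * E%:R * \sum_(r < T) a r <= F y0 - Flow
    + gamma * E%:R * (L ^+ 2 / N%:R) *
      (21 / 8 * \sum_(r < T) drift_sup r + 2 * \sum_(r < T) C r)
    + T%:R * E%:R * (2 * L * gamma ^+ 2 * (v / N%:R)).
Proof.
move=> Flow_le.
pose bound r := - (5 / 16 * gamma) * a r
    + gamma * (L ^+ 2 / N%:R) * (21 / 8 * drift_sup r + 2 * C r)
    + 2 * L * gamma ^+ 2 * (v / N%:R).
have ic (r : 'I_T) : integrable_rv P (fun w => \sum_(q < E) change r q w).
  by apply: integrable_rv_sum => q; have [] := change_le (ltn_ord r) (ltn_ord q).
have H1 : Flow - F y0 <= \int[P]_w \sum_(r < T) \sum_(q < E) change r q w.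
  have -> : Flow - F y0 = \int[P]_w (Flow - F y0).
    by rewrite Rintegral_cst// -[LHS]mulr1; congr (_ * _);
      rewrite -[LHS]/(fine 1%:E) -(probability_setT P).
  apply: le_Rintegral => //.
  - exact: integrable_rv_cst.
  - exact: integrable_rv_sum.
  - move=> w _; rewrite lerBlDl; apply: le_trans (F_rounds w T).
    exact: Flow_le.
have H2 : \int[P]_w (\sum_(r < T) \sum_(q < E) change r q w) <=
    \sum_(r < T) E%:R * bound r.
  rewrite Rintegral_sum//; apply: ler_sum => r _.
  rewrite Rintegral_sum; last first.
    by move=> q; have [] := change_le (ltn_ord r) (ltn_ord q).
  apply: (@le_trans _ _ (\sum_(q < E) bound r)).
    by apply: ler_sum => q _; have [] := change_le (ltn_ord r) (ltn_ord q).
  by rewrite sumr_const card_ord -[leLHS]mulr_natl.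
have H3 : \sum_(r < T) E%:R * bound r = E%:R * (- (5 / 16 * gamma) * \sum_(r < T) a r
    + gamma * (L ^+ 2 / N%:R) *
      (21 / 8 * \sum_(r < T) drift_sup r + 2 * \sum_(r < T) C r)
    + T%:R * (2 * L * gamma ^+ 2 * (v / N%:R))).
  rewrite -mulr_sumr; congr (_ * _); rewrite /bound !big_split; congr (_ + _ + _).
  - by rewrite mulr_sumr.
  - by rewrite -mulr_sumr big_split; congr (_ * (_ + _)); rewrite mulr_sumr.
  - by rewrite sumr_const card_ord -[LHS]mulr_natl.
have := le_trans H1 H2; rewrite H3; clear H1 H2 H3 ic.
lra_atoms.
Qed.

Lemma integrable_mean_gradient r : (r < T)%N ->
  integrable_rv P (fun w => sqn (row_mean (AG (Z r 0 w)))).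
Proof.
move=> rT; have sZ := sq_integrable_Z rT (leq0n E).
by have [] := sq_integrable_row_mean (sq_integrable_AG sZ).
Qed.

Lemma integrable_consensus_v r : (r <= T)%N ->
  integrable_rv P (fun w => sqn (consensus_error (V r w))).
Proof. by move=> /sq_integrable_round[_ /sq_integrable_consensus[]]. Qed.

Hypothesis loop_small : h / mu ^+ 4 <= (3 / 640) ^+ 2.

Let phi := D 0%N.

(** Identical initial models make [C 0] vanish, while [D 0] is [phi]; the summed recursions and the
    summed fixed-point equation are then the input of [feedback_rate]. *)
Lemma lsgt_rate (Flow : R) : (forall y, Flow <= F y) ->
  \sum_(r < T) a r <= 4 * (F y0 - Flow) / (gamma * E%:R) + 8 * T%:R * L * gamma * v / N%:R
    + gamma ^+ 2 * E%:R ^+ 2 * L ^+ 2 / mu ^+ 4 *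
      (32 * 2577 * (T%:R * v) + 3552 * (phi / N%:R)).
Proof.
move=> Flow_le; have := lsgt_descent Flow_le.
have C0 : C 0 = 0.
  rewrite /C; under eq_Rintegral do rewrite /Z consensus_error_round_y00// sqn0.
  by rewrite Rintegral_cst// mul0r.
have HC : mu / 2 * \sum_(r < T) C r <= 6 / mu * e * (\sum_(r < T) D r
    + 3 * L ^+ 2 * \sum_(r < T) drift_sup r + T%:R * (6 * s2)).
  have := sum_contraction (fun r => sqn_integral_ge0 (fun w => consensus_error (Z r 0 w)))
    consensus_y_recursion.
  by rewrite -/(C 0) C0 add0r -mulr_sumr !big_split -mulr_sumr sumr_const card_ord
    -[_ *+ T]mulr_natl.
have HD : mu / 2 * \sum_(r < T) D r <= phi + 9 / mu * (L ^+ 2 * \sum_(r < T) drift_sup r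
    + T%:R * (2 * s2)).
  have := sum_contraction (fun r => sqn_integral_ge0 (fun w => consensus_error (V r w)))
    consensus_v_recursion.
  by rewrite -mulr_sumr big_split -mulr_sumr sumr_const card_ord -[_ *+ T]mulr_natl.
have HB : \sum_(r < T) drift_sup r = 8 * \sum_(r < T) C r + 6 * e * (\sum_(r < T) D r
    + 2 * N%:R * \sum_(r < T) a r + T%:R * (8 * s2)) + 18 * h * \sum_(r < T) drift_sup r.
  transitivity (\sum_(r < T) (8 * C r + 6 * e * (D r + 2 * N%:R * a r + 8 * s2)
      + 18 * h * drift_sup r)); first by apply: eq_bigr => r _; exact: drift_supE.
  by rewrite big_split big_split -!mulr_sumr !big_split -mulr_sumr sumr_const card_ord
    -[_ *+ T]mulr_natl.
have B0 : 0 <= \sum_(r < T) drift_sup r by apply: sumr_ge0 => r _; exact: drift_sup_ge0.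
have A0 : 0 <= \sum_(r < T) a r by apply: sumr_ge0 => r _; exact: sqn_integral_ge0.
have phi0 : 0 <= phi by exact: sqn_integral_ge0.
have ER : 0 < E%:R :> R by rewrite ltr0n.
have mu1 : mu <= 1 by rewrite /mu gerBl sqr_ge0.
exact: (feedback_rate NR ER (ler0n _ T) L0 v0 gamma_gt0 mu0 mu1 loop_small
  B0 A0 phi0 HC HD HB).
Qed.

End lsgt_moments.

(** * Step size and rate *)

Section step_size.
Variables (R : realType) (N E T : nat) (lam L gamma : R).
Hypotheses (N1 : (1 < N)%N) (E0 : (0 < E)%N) (T0 : (0 < T)%N).
Hypotheses (lam0 : 0 < lam) (lam1 : lam < 1) (L0 : 0 < L).
Hypothesis gammaE : gamma = Num.sqrt (N%:R / (E%:R * T%:R)).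

Let NR : 2 <= N%:R :> R. Proof. by rewrite (ler_nat R 2). Qed.
Let ER : 1 <= E%:R :> R. Proof. by rewrite (ler_nat R 1). Qed.
Let TR : 0 < T%:R :> R. Proof. by rewrite ltr0n. Qed.

Let s := Num.sqrt (N%:R * E%:R * T%:R : R).

Let s0 : 0 < s. Proof. by rewrite sqrtr_gt0 !mulr_gt0 ?(lt_le_trans _ NR)// (lt_le_trans _ ER). Qed.

Let mu := 1 - lam ^+ 2.

Lemma lsgt_step_gt0 : 0 < gamma.
Proof. by rewrite gammaE sqrtr_gt0 divr_gt0 ?mulr_gt0 ?(lt_le_trans _ NR)// (lt_le_trans _ ER). Qed.

Lemma lsgt_stepE : gamma = N%:R / s.
Proof.
have N0 : 0 < N%:R :> R by exact: lt_le_trans NR.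
have E0' : 0 < E%:R :> R by exact: lt_le_trans ER.
rewrite gammaE; have -> : N%:R / (E%:R * T%:R) = (N%:R / s) ^+ 2.
  rewrite expr_div_n sqr_sqrtr; last by rewrite !mulr_ge0// ltW.
  by field; rewrite !gt_eqF.
by rewrite sqrtr_sqr gtr0_norm// divr_gt0.
Qed.

Hypothesis h_iii : gamma <= mu / (3600 * E%:R * N%:R * L).
Hypothesis h_v : gamma <= 3 * mu ^+ 2 / (320 * (1 + 7 * lam ^+ 2) * (1 + lam ^+ 2)
                     * (1 + 8 * (E%:R - 1) * lam) * N%:R * L).

(* Condition (iii) gives the bound when lam is small, condition (v) otherwise. *)
Lemma lsgt_step_small : gamma * E%:R * N%:R * L <= 3 / 320 * mu ^+ 2.
Proof.
have g0 := lsgt_step_gt0.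
have N0 : 0 < N%:R :> R by exact: lt_le_trans NR.
have E0' : 0 < E%:R :> R by exact: lt_le_trans ER.
have l20 := sqr_ge0 lam.
(* For lam >= 1/8 the factor 1 + 8 (E - 1) lam in (v) is at least E. Below that threshold mu >=
   63/64, so the mu of (iii) is at most (64/63) mu^2, and 1/3600 leaves ample room. *)
have [lam8|lam8] := leP 8^-1 lam.
  have lE : 0 <= (E%:R - 1) * (8 * lam - 1) by rewrite mulr_ge0 ?subr_ge0//; lra.
  have lE2 : 0 <= (E%:R - 1) * lam by rewrite mulr_ge0 ?subr_ge0// ltW.
  have a1 : 1 <= 1 + 7 * lam ^+ 2 by lra.
  have a2 : 1 <= 1 + lam ^+ 2 by lra.
  have a3 : E%:R <= 1 + 8 * (E%:R - 1) * lam by lra.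
  move: h_v; rewrite ler_pdivlMr; last by rewrite !mulr_gt0//; lra.
  have P1 : 1 <= (1 + 7 * lam ^+ 2) * (1 + lam ^+ 2) by rewrite mulr_ege1.
  have P2 : E%:R <= (1 + 7 * lam ^+ 2) * (1 + lam ^+ 2) * (1 + 8 * (E%:R - 1) * lam).
    by rewrite (le_trans a3)// ler_peMl//; lra.
  have gNL : 0 <= gamma * N%:R * L by rewrite !mulr_ge0// ltW.
  have := ler_wpM2l gNL P2; lra.
have c : 0 < 3600 :> R by rewrite ltr0n.
move: h_iii; rewrite ler_pdivlMr; last exact: (mulr_gt0 (mulr_gt0 (mulr_gt0 c E0') N0) L0).
have l2 : lam ^+ 2 <= 64^-1.
  have -> : 64^-1 = (8^-1) ^+ 2 :> R by rewrite exprVn; congr (_^-1); ring.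
  by rewrite ler_pXn2r ?nnegrE// ltW.
have mu1 : 63 / 64 <= mu by rewrite /mu; lra.
have : 63 / 64 * mu <= mu ^+ 2 by rewrite expr2 ler_wpM2r//; lra.
lra.
Qed.

Let mu0 : 0 < mu. Proof. by rewrite subr_gt0 expr_lt1// ltW. Qed.
Let mu1 : mu <= 1. Proof. by rewrite /mu; have := sqr_ge0 lam; lra. Qed.

(** N >= 2 halves the constant 3/320 of [lsgt_step_small]; the rest is squaring. *)
Lemma lsgt_loop_small :
  gamma ^+ 2 * E%:R ^+ 2 * L ^+ 2 / mu ^+ 4 <= (3 / 640) ^+ 2.
Proof.
have g0 := lsgt_step_gt0; have := lsgt_step_small.
have gEL : 0 <= gamma * E%:R * L by rewrite !mulr_ge0// ltW.
move=> H; have {}H : gamma * E%:R * L <= 3 / 640 * mu ^+ 2.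
  by have := ler_wpM2l gEL NR; lra.
rewrite ler_pdivrMr ?exprn_gt0//.
have -> : gamma ^+ 2 * E%:R ^+ 2 * L ^+ 2 = (gamma * E%:R * L) ^+ 2 by ring.
have -> : (3 / 640) ^+ 2 * mu ^+ 4 = (3 / 640 * mu ^+ 2) ^+ 2 by field.
have c : 0 <= 3 / 640 :> R by lra.
apply: lerXn2r; [by rewrite nnegrE| |exact: H].
by rewrite nnegrE; exact: (mulr_ge0 c (sqr_ge0 mu)).
Qed.

Lemma lsgt_drift_small : 18 * (gamma ^+ 2 * E%:R ^+ 2 * L ^+ 2) < 1.
Proof.
have := lsgt_loop_small; rewrite ler_pdivrMr ?exprn_gt0// => H.
have : mu ^+ 4 <= 1 by rewrite exprn_ile1// ltW.
by move: (mu ^+ 4) H => m; lra.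
Qed.

Lemma lsgt_descent_small : 2 * L * gamma <= 8^-1.
Proof.
have g0 := lsgt_step_gt0; have := lsgt_step_small.
have : mu ^+ 2 <= 1 by rewrite exprn_ile1// ltW.
have N1' : 1 <= N%:R :> R by apply: le_trans NR; rewrite (ler_nat R 1).
have EN : 1 <= E%:R * N%:R :> R by rewrite mulr_ege1.
have gL : 0 <= gamma * L by rewrite mulr_ge0// ltW.
have := ler_wpM2l gL EN; lra.
Qed.

Hypothesis hET : E%:R <= (T%:R / N%:R ^+ 5) `^ (3%:R^-1) :> R.

(** N^5 E^3 <= T gives (N^3 E^2)^2 = N E (N^5 E^3) <= s^2. As gamma = N/s, the claim reads 2 N^2 E^2
    <= s, and 2 <= N. *)
Lemma lsgt_step_rounds : 2 * (gamma ^+ 2 * E%:R ^+ 2) <= s^-1.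
Proof.
have N0 : 0 < N%:R :> R by exact: lt_le_trans NR.
have E0' : 0 < E%:R :> R by exact: lt_le_trans ER.
have E3 : N%:R ^+ 5 * E%:R ^+ 3 <= T%:R :> R.
  rewrite mulrC -ler_pdivlMr ?exprn_gt0//.
  have x0 : 0 <= T%:R / N%:R ^+ 5 :> R by rewrite divr_ge0 ?exprn_ge0// ltW.
  have <- : ((T%:R / N%:R ^+ 5) `^ (3%:R^-1)) ^+ 3 = T%:R / N%:R ^+ 5 :> R.
    by rewrite -powR_mulrn ?powR_ge0// -powRrM mulVf ?pnatr_eq0// powRr1.
  by rewrite ler_pXn2r ?nnegrE ?powR_ge0.
have : N%:R ^+ 3 * E%:R ^+ 2 <= s.
  rewrite -(ler_pXn2r (n := 2))// ?nnegrE ?mulr_ge0 ?exprn_ge0 ?(ltW s0)//.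
  rewrite sqr_sqrtr; last by rewrite !mulr_ge0// ltW.
  have -> : (N%:R ^+ 3 * E%:R ^+ 2) ^+ 2 = N%:R * E%:R * (N%:R ^+ 5 * E%:R ^+ 3) :> R.
    by ring.
  by rewrite ler_wpM2l// mulr_ge0// ltW.
move=> H; rewrite lsgt_stepE -(ler_pM2r (exprn_gt0 2 s0)).
have -> : 2 * ((N%:R / s) ^+ 2 * E%:R ^+ 2) * s ^+ 2 = 2 * (N%:R ^+ 2 * E%:R ^+ 2).
  by field; rewrite gt_eqF.
have -> : s^-1 * s ^+ 2 = s by field; rewrite gt_eqF.
apply: le_trans H.
have -> : N%:R ^+ 3 * E%:R ^+ 2 = N%:R * (N%:R ^+ 2 * E%:R ^+ 2) :> R by ring.
by rewrite ler_wpM2r// mulr_ge0// exprn_ge0// ltW.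
Qed.

Lemma lsgt_stepET : gamma * E%:R * T%:R = s.
Proof.
have ss : s ^+ 2 = N%:R * E%:R * T%:R by rewrite sqr_sqrtr// !mulr_ge0.
have -> : gamma * E%:R * T%:R = N%:R * E%:R * T%:R / s by rewrite lsgt_stepE; ring.
by rewrite -ss expr2 mulfK// gt_eqF.
Qed.

End step_size.

(** Since gamma E T = s, the first term becomes exactly 4 Delta / s. The noise term is 8 L v / s,
    relaxed to 40. In the third, 32 = 16 * 2 and the 2 is absorbed by 2 (gamma E)^2 <= 1/s; [c] will
    be (1 + 7 lam^2)^2. *)
Lemma lsgt_rate_rescale (R : realType) (N E T s gamma L mu v c A Delta phi : R) :
  0 < N -> 0 < E -> 0 < T -> 0 < s -> 0 < L -> 0 < mu -> 0 <= v -> 0 <= phi -> 1 <= c ->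
  gamma * E * T = s -> gamma = N / s -> 2 * (gamma ^+ 2 * E ^+ 2) <= s^-1 ->
  A <= 4 * Delta / (gamma * E) + 8 * T * L * gamma * v / N
    + gamma ^+ 2 * E ^+ 2 * L ^+ 2 / mu ^+ 4 * (32 * 2577 * (T * v) + 3552 * (phi / N)) ->
  T^-1 * A <= 4 * Delta / s + 40 * L * v / s
    + 16 * c * L ^+ 2 / (mu ^+ 4 * s) * (2577 * v + 111 / (N * T) * phi).
Proof.
move=> N0 E0 T0 s0 L0 mu0 v0 phi0 c1 sE gE gs rate.
have g0 : 0 < gamma by rewrite gE divr_gt0.
have [Nnz Enz Tnz] : [/\ N != 0, E != 0 & T != 0] by rewrite !gt_eqF.
have [snz gnz munz] : [/\ s != 0, gamma != 0 & mu != 0] by rewrite !gt_eqF.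
have c2577 : 0 <= 2577 :> R by exact: ler0n.
set Q := 2577 * v + _.
have Q0 : 0 <= Q.
  by rewrite addr_ge0 ?(mulr_ge0 c2577)// mulr_ge0// divr_ge0// ltW// mulr_gt0.
have eQ : 32 * 2577 * (T * v) + 3552 * (phi / N) = 32 * T * Q.
  have -> : 3552 = 32 * 111 :> R by rewrite -natrM.
  by rewrite /Q; move: (2577 : R) (111 : R) => x y; field; rewrite Nnz Tnz.
rewrite eQ in rate.
have Ti : 0 <= T^-1 by rewrite invr_ge0 ltW.
apply: le_trans (ler_wpM2l Ti rate) _; rewrite (mulrDr T^-1) (mulrDr T^-1).
apply: lerD; first apply: lerD.
- rewrite le_eqVlt; apply/orP; left; apply/eqP; rewrite -sE.
  by field; rewrite Tnz Enz gnz.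
- have -> : T^-1 * (8 * T * L * gamma * v / N) = 8 * (L * v / s).
    by rewrite gE; field; rewrite snz Tnz Nnz.
  have -> : 40 * L * v / s = 40 * (L * v / s) by rewrite !mulrA.
  by rewrite ler_wpM2r ?divr_ge0 ?mulr_ge0 ?(ltW L0) ?(ltW s0)// ler_nat.
- have -> : T^-1 * (gamma ^+ 2 * E ^+ 2 * L ^+ 2 / mu ^+ 4 * (32 * T * Q)) =
      16 * L ^+ 2 / mu ^+ 4 * Q * (2 * (gamma ^+ 2 * E ^+ 2)).
    by field; rewrite Tnz munz.
  have -> : 16 * c * L ^+ 2 / (mu ^+ 4 * s) * Q = 16 * L ^+ 2 / mu ^+ 4 * Q * (c * s^-1).
    by field; rewrite snz munz.
  apply: ler_wpM2l; last by apply: le_trans gs _; rewrite ler_peMl// invr_ge0 ltW.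
  apply: mulr_ge0 => //; apply: divr_ge0; last by rewrite exprn_ge0// ltW.
  by apply: mulr_ge0; [exact: ler0n|exact: sqr_ge0].
Qed.

Lemma consensus_mx_singleton (R : realType) N (W : 'M[R]_N) : N = 1%N ->
  W *m (const_mx 1 : 'cV[R]_N) = const_mx 1 -> W - N%:R^-1 *: const_mx 1 = 0.
Proof.
move=> N1; subst N => /matrixP/(_ 0 0); rewrite !mxE big_ord1 mxE mulr1 => W00.
by apply/matrixP => i j; rewrite !ord1 !mxE W00 invr1 mulr1 subrr.
Qed.

(** Unbiasedness and variance are assumed at deterministic points only. Expectations are extended
    reals, so finiteness of each one is established along the way. *)
Theorem corollary1 (R : realType) (N p b : nat)
  (hN : (0 < N)%N) (hb : (0 < b)%N)
  (* network *)
  (edge : rel 'I_N) (W : 'M[R]_N) (lam : R)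
  (hgraph : connected_graph edge)
  (hW : mixing_matrix edge W)
  (hlam : lam = largest_singular_value (W - N%:R^-1 *: const_mx 1))
  (hlam1 : `|lam| < 1)
  (* problem *)
  (dX : measure_display) (Xi : 'I_N -> measurableType dX)
  (D : forall n, probability (Xi n) R)
  (l : forall n, 'rV[R]_p -> Xi n -> R)
  (hl_int : forall n y, (D n).-integrable setT (EFin \o l n y))
  (hl_diff : forall n xi y, differentiable (fun z => l n z xi) y)
  (hf_diff : forall n y, differentiable (local_objective D l n) y)
  (Flow L sigma : R)
  (hFlow : forall y, Flow <= objective D l y)
  (hL : 0 < L)
  (hf_lip : forall n y y',
    fnorm (gradient (local_objective D l n) y - gradient (local_objective D l n) y')
    <= L * fnorm (y - y'))
  (* algorithm parameters *)
  (E T : nat) (gamma : R)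
  (hE : (1 <= E)%N) (hT : (1 <= T)%N)
  (hgamma : gamma = Num.sqrt (N%:R / (E%:R * T%:R)))
  (hET : E%:R <= (T%:R / N%:R ^+ 5) `^ (3%:R^-1) :> R)
  (* mini-batches for the initialization and the rounds 0, ..., T *)
  (dO : measure_display) (Omega : measurableType dO) (P : probability Omega R)
  (I : forall n, nat -> Omega -> b.-tuple (Xi n))
  (hI_meas : forall n k, (k <= T.+1 * E)%N -> measurable_fun setT (I n k))
  (hI_indep : @mutually_independent _ _ Omega R P ('I_N * 'I_(T.+1 * E).+1)%type
    (fun nk => b.-tuple (Xi nk.1)) (fun nk => I nk.1 nk.2))
  (hI_unbiased : forall n k y i, (k <= T.+1 * E)%N ->
    'E_P[fun w => (minibatch_gradient l y (I n k w) 0%R i : R)]%E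
    = (gradient (local_objective D l n) y 0 i)%:E)
  (hI_var : forall n k y, (k <= T.+1 * E)%N ->
    ('E_P[fun w => (fnorm (minibatch_gradient l y (I n k w)
                           - gradient (local_objective D l n) y) ^+ 2)%R]
     <= (sigma ^+ 2 / b%:R)%:E)%E)
  (y0 : 'rV[R]_p)
  (* step size conditions *)
  (hgamma1 : gamma < 1)
  (h_i : gamma <= lam ^+ 2 / (32 * E%:R * N%:R * L))
  (h_ii : (1 < E)%N ->
    gamma <= (1 - lam ^+ 2) ^+ 2
             / (32 * L ^+ 2 * (1 + 7 * lam ^+ 2)
                * (8 * (1 + 16 * lam ^+ 2) * (E%:R - 1) ^+ 2)))
  (h_iii : gamma <= (1 - lam ^+ 2) / (3600 * E%:R * N%:R * L))
  (h_iv : exists s1 s2 : R, [/\ 0 < s1, 0 < s2,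
    s1 < (1 - lam ^+ 2) ^+ 2
         / (40 * (1 + 7 * lam ^+ 2) * (1 + lam ^+ 2) * L ^+ 2) * s2 &
    gamma <= 3 * (1 - lam ^+ 2) * s1
             / (16 * (1 + 7 * lam ^+ 2) * (1 + 8 * (E%:R - 1) * lam) * s2)])
  (h_v : gamma <= 3 * (1 - lam ^+ 2) ^+ 2
                  / (320 * (1 + 7 * lam ^+ 2) * (1 + lam ^+ 2)
                     * (1 + 8 * (E%:R - 1) * lam) * N%:R * L))
  (h_vi : gamma <= (62 * E%:R * (1 + lam ^+ 2) * N%:R * L)^-1)
  (h_vii : gamma <= (1 - lam ^+ 2) / (320 * E%:R ^+ 2 * N%:R * L)) :
  let state r w := lsgt l W E gamma y0 (fun n k => I n k w) r in
  let V0 w := iter_v (state 0%N w) in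
  let phi_v0 := 'E_P[fun w =>
    (fnorm (V0 w - (const_mx 1 : 'cV[R]_N) *m row_mean (V0 w)) ^+ 2)%R]%E in
  let sNET := Num.sqrt (N%:R * E%:R * T%:R : R) in
  ((T%:R^-1)%:E * \sum_(0 <= r < T)
     'E_P[fun w => (fnorm (N%:R^-1 *: \sum_(n < N)
            gradient (local_objective D l n) (row n (iter_y (state r w)))) ^+ 2)%R]
   <= (4 * (objective D l y0 - Flow) / sNET)%:E
      + (40 * L * sigma ^+ 2 / (sNET * b%:R))%:E
      + (16 * (1 + 7 * lam ^+ 2) ^+ 2 * L ^+ 2 / ((1 - lam ^+ 2) ^+ 4 * sNET))%:E
        * ((2577 * sigma ^+ 2 / b%:R)%:E
           + (111 / (N%:R * T%:R))%:E * phi_v0))%E.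
Proof.
cbv zeta.
have [_ _ W1 W2] := hW.
set A := W - N%:R^-1 *: const_mx 1 in hlam.
have [lam_ge0 [x0 _ [lamE _]]] := largest_singular_value_spec hN A.
rewrite -hlam in lam_ge0 lamE.
have opW (X : 'M[R]_(N, p)) : sqn (A *m X) <= lam ^+ 2 * sqn X.
  by rewrite hlam; exact: sqn_mulmx_le.
have lam_lt1 : lam < 1 by rewrite -(ger0_norm lam_ge0).
have gamma_gt0 : 0 < gamma.
  by rewrite hgamma sqrtr_gt0 divr_gt0 ?mulr_gt0 ?ltr0n.
(* With lam = 0, condition (i) would read gamma <= 0. *)
have lam_gt0 : 0 < lam.
  rewrite lt_def lam_ge0 andbT; apply/eqP => lam0.
  by move: h_i; rewrite lam0 expr0n mul0r leNgt gamma_gt0.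
(* For a single agent W - 11^T/N is zero, and so would be lam, which is the norm of its image of a
   unit vector. *)
have N1 : (1 < N)%N.
  rewrite ltnNge; apply/negP => N1; have N_1 : N = 1%N by apply/eqP; rewrite eqn_leq N1.
  have A0 : A = 0 by exact: consensus_mx_singleton.
  by move: lamE; rewrite A0 trmx0 mulmx0 sqn0 => /eqP; rewrite expf_eq0 gt_eqF.
have v0 : 0 <= sigma ^+ 2 / b%:R by rewrite divr_ge0 ?sqr_ge0.
have f_lip n y y' : sqn (gradient (local_objective D l n) y
    - gradient (local_objective D l n) y') <= L ^+ 2 * sqn (y - y').
  rewrite -!fnorm_sqr -exprMn; apply: lerXn2r; rewrite ?nnegrE; last exact: hf_lip.
    exact: sqrtr_ge0.
  by apply: mulr_ge0; [exact: ltW|exact: sqrtr_ge0].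
have ml n y : measurable_fun setT (l n y : Xi n -> R).
  exact/measurable_EFinP/(measurable_int (D n) (hl_int n y)).
have lam2 : lam ^+ 2 < 1 by rewrite expr_lt1.
have rate := @lsgt_rate R N p b W lam hN W1 W2 opW lam2 dX Xi l (local_objective D l) ml
  hl_diff hf_diff L (sigma ^+ 2 / b%:R) hL f_lip E T gamma y0 hE dO Omega P I hI_meas
  hI_indep hI_unbiased hI_var
  (lsgt_drift_small N1 hE hT lam_gt0 lam_lt1 hL hgamma h_iii h_v) v0 gamma_gt0
  (lsgt_descent_small N1 hE hT lam_gt0 lam_lt1 hL hgamma h_iii h_v)
  (lsgt_loop_small N1 hE hT lam_gt0 lam_lt1 hL hgamma h_iii h_v) Flow hFlow.
rewrite /= in rate.
set s := Num.sqrt _.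
have sE : gamma * E%:R * T%:R = s := lsgt_stepET N1 hE hT hgamma.
have s_gt0 : 0 < s by rewrite -sE !mulr_gt0 ?ltr0n.
have N0 : 0 < N%:R :> R by rewrite ltr0n.
have T0 : 0 < T%:R :> R by rewrite ltr0n.
(* Integrability turns every extended expectation into a real integral, after which the inequality
   is one between real numbers. *)
have iv : integrable_rv P (fun w => sqn (consensus_error
    (round_v l W E gamma y0 (fun n k => I n k w) 0))).
  exact: (integrable_consensus_v hN W1 W2 opW lam2 ml hl_diff hL f_lip gamma y0 hE hI_meas
    hI_indep hI_var (leq0n T)).
have ia r (rT : (r < T)%N) : integrable_rv P (fun w => sqn (row_mean
    (agent_gradients (local_objective D l)
      (round_y l W E gamma y0 (fun n k => I n k w) r 0)))).
  exact: (integrable_mean_gradient hN W1 W2 opW lam2 ml hl_diff hL f_lip gamma y0 hE hI_meas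
    hI_indep hI_var rT).
set phi := 'E_P[_]%E.
have phiE : phi = (\int[P]_w sqn (consensus_error
    (round_v l W E gamma y0 (fun n k => I n k w) 0)))%:E.
  rewrite /Rintegral fineK; last exact: integrable_fin_num.
  by rewrite /phi unlock; apply: eq_integral => w _; rewrite fnorm_sqr.
rewrite phiE big_mkord.
under eq_bigr => r _.
  rewrite (_ : 'E_P[_] = (\int[P]_w sqn (row_mean (agent_gradients (local_objective D l)
      (round_y l W E gamma y0 (fun n k => I n k w) r 0))))%:E)%E; last first.
    rewrite /Rintegral fineK; last by apply: integrable_fin_num => //; exact: ia.
    rewrite unlock; apply: eq_integral => w _.
    by rewrite fnorm_sqr row_mean_agent_gradients.
  over.
rewrite sumEFin -!EFinM -!EFinD -?EFinM -?EFinD lee_fin.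
have -> : 40 * L * sigma ^+ 2 / (s * b%:R) = 40 * L * (sigma ^+ 2 / b%:R) / s.
  by rewrite invfM; ring.
have -> : 2577 * sigma ^+ 2 / b%:R = 2577 * (sigma ^+ 2 / b%:R) by rewrite mulrA.
apply: (@lsgt_rate_rescale R N%:R E%:R T%:R s gamma L (1 - lam ^+ 2)) => //.
- by rewrite ltr0n.
- by rewrite subr_gt0.
- by apply: Rintegral_ge0 => w _; exact: sqn_ge0.
- by rewrite exprn_ege1// lerDl mulr_ge0// sqr_ge0.
- exact: lsgt_stepE N1 hE hT hgamma.
- exact: lsgt_step_rounds N1 hE hT hgamma hET.
Qed.
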